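(* Let $E$ be a Banach space which admits an infinite-dimensional, separable quotient space, and let $1\le p<\infty$. Then $I_{w^*}[E]\nsubseteq\mathrm{FBL}^p[E]$, and hence $\mathrm{FBL}^p[E]\subsetneq\overline{I_{w^*}[E]}$.
   Context: All Banach spaces are real. Let $E$ be a Banach space with dual $E^*$, and let $B_{E^*}$ be the closed unit ball of $E^*$. A function $f\colon E^*\to\mathbb{R}$ is positively homogeneous if $f(\lambda x^* )=\lambda f(x^* )$ for all $x^*\in E^*$ and $\lambda\in[0,\infty)$. $H[E]$ is the vector lattice of all positively homogeneous functions $E^*\to\mathbb{R}$ with pointwise operations. For $x\in E$, $\delta_x\in H[E]$ is $\delta_x(x^* )=x^*(x)$. For $x_1^*,\dots,x_n^*\in E^*$, set $\|(x_j^* )_{j=1}^n\|_{p,\mathrm{weak}}=\sup_{\|x\|\le1}\bigl(\sum_{j=1}^n|x_j^*(x)|^p\bigr)^{1/p}$, and for $f\in H[E]$ set $\|f\|_{\mathrm{FBL}^p[E]}=\sup\bigl\{\bigl(\sum_{j=1}^n|f(x_j^* )|^p\bigr)^{1/p}: n\in\mathbb{N},\ (x_j^* )_{j=1}^n\subset E^*,\ \|(x_j^* )_{j=1}^n\|_{p,\mathrm{weak}}\le1\bigr\}\in[0,\infty]$. - $H^p[E]=\{f\in H[E]:\|f\|_{\mathrm{FBL}^p[E]}<\infty\}$, a Banach lattice in the norm $\|\cdot\|_{\mathrm{FBL}^p[E]}$. - $\mathrm{FBL}^p[E]$ is the closed sublattice of $H^p[E]$ generated by $\{\delta_x:x\in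 E\}$. - $I[E]$ is the (order) ideal of $H[E]$ generated by $\{\delta_x:x\in E\}$; it is contained in $H^p[E]$. - $H_{w^*}[E]=\{f\in H[E]: f|_{B_{E^*}}\text{ is weak*-continuous}\}$. - $I_{w^*}[E]=I[E]\cap H_{w^*}[E]$. $\overline{S}$ denotes the closure of $S\subseteq H^p[E]$ in the norm $\|\cdot\|_{\mathrm{FBL}^p[E]}$. A quotient space of $E$ is a space $E/W$ with $W$ a closed subspace of $E$. *)

(* Defs.v *)
From HB Require Import structures.
From mathcomp Require Import all_boot all_order all_algebra.
From mathcomp Require Import generic_quotient ring_quotient.
From mathcomp Require Import all_classical all_reals all_analysis.

Set Implicit Arguments.
Unset Strict Implicit.
Unset Printing Implicit Defensive.

Import Order.TTheory GRing.Theory Num.Theory.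
Import numFieldNormedType.Exports.
Local Open Scope classical_set_scope.
Local Open Scope ring_scope.

Section DualSpace.
Context {R : realType} (E : normedModType R).

Definition dual_pred : {pred E -> R^o} :=
  [pred f : E -> R^o | `[< linear f /\ continuous f >]].

Lemma dual_submod_closed : submod_closed dual_pred.
Proof.
split=> [|a f g /asboolP[lf cf] /asboolP[lg cg]]; apply/asboolP; split.
- by move=> k x y /=; rewrite scaler0 addr0.
- by move=> x; exact: cst_continuous.
- move=> k x y; rewrite !/(_ + _) /= !/(_ *: _) /=.
  rewrite -!/(_ + _) -!/(_ *: _) lf lg !/(_ *: _) /=.
  by rewrite !mulrDr !mulrA [k * a]mulrC addrACA.
- move=> x; rewrite /continuous_at; apply: (@cvgD R R^o); last exact: cg.
  by apply: cvgZl_tmp; exact: cf.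
Qed.

HB.instance Definition _ :=
  GRing.isSubmodClosed.Build R (E -> R^o) dual_pred dual_submod_closed.

Definition dual_space := {f : E -> R^o | f \in dual_pred}.

HB.instance Definition _ := SubChoice.on dual_space.
HB.instance Definition _ := [SubChoice_isSubLmodule of dual_space by <:].

Definition dual_fun (xs : dual_space) : E -> R := \val xs.
Coercion dual_fun : dual_space >-> Funclass.

Definition unit_ball : set E := [set x | `|x| <= 1].

Definition dual_norm (xs : dual_space) : \bar R :=
  ereal_sup [set (`|xs x|)%:E | x in unit_ball].

Definition dual_unit_ball : set dual_space := [set xs | (dual_norm xs <= 1)%E].

(* The weak* topology is that of pointwise convergence on E. *)
Definition weak_star : Type :=
  @initial_topology dual_space {ptws E -> R} dual_fun.

HB.instance Definition _ := Topological.copy weak_star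
  (@initial_topology dual_space {ptws E -> R} dual_fun).

End DualSpace.

Arguments unit_ball {R} E.
Arguments dual_unit_ball {R} E.

Record closed_subspace (R : realType) (E : normedModType R) := ClosedSubspace {
  subspace_set :> set E ;
  subspace_submod : submod_closed [in subspace_set] ;
  subspace_closed : closed subspace_set }.

Section QuotientSpace.
Context {R : realType} (E : normedModType R) (W : closed_subspace E).
Local Open Scope quotient_scope.

Definition subspace_pred : {pred E} := [in subspace_set W].

HB.instance Definition _ := GRing.isSubmodClosed.Build R E subspace_pred
  (@subspace_submod R E W).

Definition quotient_space := Quotient.quot subspace_pred.

HB.instance Definition _ := GRing.Zmodule.on quotient_space.

Definition quotient_map (x : E) : quotient_space :=
  \pi_(Quotient.quot subspace_pred) x.

Lemma quotient_map_surj q : exists x, quotient_map x = q.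
Proof. by exists (repr q); rewrite /quotient_map reprK. Qed.

Lemma quotient_mapD x y :
  quotient_map (x + y) = quotient_map x + quotient_map y.
Proof. exact: Quotient.pi_add. Qed.

Lemma quotient_map0 : quotient_map 0 = 0.
Proof. by apply: (addIr (quotient_map 0)); rewrite -quotient_mapD !add0r. Qed.

Lemma eq_quotient_map x y : quotient_map x = quotient_map y <-> (W : set E) (x - y).
Proof.
have E1 : (x - y \in subspace_pred) = (quotient_map x == quotient_map y).
  exact: Quotient.idealrBE.
by split=> [/eqP|/mem_set ?]; [rewrite -E1 => /set_mem|apply/eqP; rewrite -E1].
Qed.

Definition quotient_scale (a : R) (q : quotient_space) : quotient_space :=
  quotient_map (a *: repr q).

Lemma quotient_mapZ a x :
  quotient_scale a (quotient_map x) = quotient_map (a *: x).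
Proof.
apply/eq_quotient_map; rewrite -scalerBr; apply/set_mem.
apply: (rpredZ a (_ : _ \in subspace_pred)); apply/mem_set/eq_quotient_map.
by rewrite /quotient_map reprK.
Qed.

Lemma quotient_scaleA a b q :
  quotient_scale a (quotient_scale b q) = quotient_scale (a * b) q.
Proof. by have [x <-] := quotient_map_surj q; rewrite !quotient_mapZ scalerA. Qed.

Lemma quotient_scale1 : left_id 1 quotient_scale.
Proof.
by move=> q; have [x <-] := quotient_map_surj q; rewrite quotient_mapZ scale1r.
Qed.

Lemma quotient_scaleDr : right_distributive quotient_scale +%R.
Proof.
move=> a q r.
have [x <-] := quotient_map_surj q; have [y <-] := quotient_map_surj r.
by rewrite -quotient_mapD !quotient_mapZ scalerDr quotient_mapD.
Qed.

Lemma quotient_scaleDl q : {morph quotient_scale^~ q : a b / a + b}.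
Proof.
move=> a b; have [x <-] := quotient_map_surj q.
by rewrite !quotient_mapZ scalerDl quotient_mapD.
Qed.

HB.instance Definition _ := GRing.Zmodule_isLmodule.Build R quotient_space
  quotient_scaleA quotient_scale1 quotient_scaleDr quotient_scaleDl.

Definition quotient_norm (q : quotient_space) : R :=
  inf [set `|x| | x in [set x | quotient_map x = q]].

Lemma quotient_norm_le x : quotient_norm (quotient_map x) <= `|x|.
Proof.
apply: ge_inf; last by exists x.
by exists 0 => _ [y _ <-].
Qed.

Lemma le_quotient_norm m q :
  (forall x, quotient_map x = q -> m <= `|x|) -> m <= quotient_norm q.
Proof.
move=> mq; have [x xq] := quotient_map_surj q.
apply: lb_le_inf => [|_ [y yq <-]]; last exact: mq.
by exists `|x|, x.
Qed.

Lemma quotient_norm_ge0 q : 0 <= quotient_norm q.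
Proof. exact: le_quotient_norm. Qed.

Lemma quotient_normD q r :
  quotient_norm (q + r) <= quotient_norm q + quotient_norm r.
Proof.
rewrite -lerBlDr; apply: le_quotient_norm => x xq.
rewrite lerBlDl -lerBlDr; apply: le_quotient_norm => y yr.
rewrite lerBlDl -xq -yr -quotient_mapD.
exact: le_trans (quotient_norm_le _) (ler_normD _ _).
Qed.

Lemma quotient_normZ (a : R) q :
  quotient_norm (a *: q) = `|a| * quotient_norm q.
Proof.
have leZ b r : b != 0 -> quotient_norm (b *: r) <= `|b| * quotient_norm r.
  move=> b0; rewrite -ler_pdivrMl ?normr_gt0//.
  apply: le_quotient_norm => x <-.
  rewrite ler_pdivrMl ?normr_gt0// -normrZ.
  by rewrite [_ *: _]quotient_mapZ quotient_norm_le.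
have [->|a0] := eqVneq a 0.
  rewrite scale0r normr0 mul0r; apply/eqP; rewrite eq_le quotient_norm_ge0 andbT.
  by rewrite -quotient_map0 -[leRHS](@normr0 _ E) quotient_norm_le.
apply/eqP; rewrite eq_le leZ//=.
rewrite -ler_pdivlMl ?normr_gt0// -normfV.
by rewrite -[X in quotient_norm X](scalerK a0) leZ ?invr_eq0.
Qed.

Lemma quotient_norm0_eq0 q : quotient_norm q = 0 -> q = 0.
Proof.
have [x <-] := quotient_map_surj q => q0.
rewrite -quotient_map0; apply/eq_quotient_map; rewrite subr0; apply: subspace_closed.
move=> B /nbhs_ballP[e /= e0 eB].
have [y [yx ye]] : exists y, quotient_map y = quotient_map x /\ `|y| < e.
  apply: contrapT => h; suff : e <= 0 by rewrite leNgt e0.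
  rewrite -q0; apply: le_quotient_norm => y yx; rewrite leNgt; apply/negP => ye.
  by apply: h; exists y.
exists (x - y); split; first exact/eq_quotient_map.
by apply: eB; rewrite -ball_normE /ball_/= opprB addrC subrK.
Qed.

HB.instance Definition _ := Lmodule_isNormed.Build R quotient_space
  quotient_normD quotient_normZ quotient_norm0_eq0.

End QuotientSpace.

Definition finite_dimensional (R : realType) (V : lmodType R) : Prop :=
  exists n (v : 'I_n -> V), forall x, exists c : 'I_n -> R,
    x = \sum_(i < n) c i *: v i.

Definition separable (T : topologicalType) : Prop :=
  exists2 D : set T, countable D & dense D.

Section FreeBanachLattice.
Context {R : realType} (E : normedModType R).
Implicit Types (f g : dual_space E -> R) (A J S : set (dual_space E -> R)).

Definition pos_homogeneous f : Prop :=
  forall (l : R) (xs : dual_space E), 0 <= l -> f (l *: xs) = l * f xs.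

Definition HE : set (dual_space E -> R) := [set f | pos_homogeneous f].

Definition delta (x : E) : dual_space E -> R := fun xs => xs x.

Definition weak_pnorm (p : R) n (xs : 'I_n -> dual_space E) : \bar R :=
  ereal_sup [set ((\sum_(j < n) `|xs j x| `^ p) `^ p^-1)%:E | x in unit_ball E].

Definition fbl_norm (p : R) f : \bar R :=
  ereal_sup [set r | exists n (xs : 'I_n -> dual_space E),
    (weak_pnorm p xs <= 1)%E /\
    r = ((\sum_(j < n) `|f (xs j)| `^ p) `^ p^-1)%:E].

Definition HpE (p : R) : set (dual_space E -> R) :=
  [set f | HE f /\ (fbl_norm p f < +oo)%E].

Definition HpE_closure (p : R) S : set (dual_space E -> R) :=
  [set f | HpE p f /\ forall e : R, 0 < e ->
    exists2 g, S g & (fbl_norm p (fun xs => f xs - g xs)%R < e%:E)%E].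

Definition linear_subspace A : Prop :=
  A (fun=> 0) /\
  forall (a : R) f g, A f -> A g -> A (fun xs => a * f xs + g xs).

Definition sublattice A : Prop :=
  linear_subspace A /\
  forall f g, A f -> A g ->
    A (fun xs => Num.max (f xs) (g xs)) /\ A (fun xs => Num.min (f xs) (g xs)).

Definition closed_sublattice (p : R) A : Prop :=
  [/\ A `<=` HpE p, sublattice A & HpE_closure p A `<=` A].

Definition order_ideal J : Prop :=
  [/\ J `<=` HE, linear_subspace J &
    forall f g, HE f -> J g -> (forall xs, `|f xs| <= `|g xs|) -> J f].

Definition FBL (p : R) : set (dual_space E -> R) :=
  smallest (closed_sublattice p) (range delta).

Definition IE : set (dual_space E -> R) := smallest order_ideal (range delta).

Definition HE_wstar : set (dual_space E -> R) :=
  [set f | HE f /\ {within (dual_unit_ball E : set (weak_star E)),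
    continuous (f : weak_star E -> R)}].

Definition IE_wstar : set (dual_space E -> R) := IE `&` HE_wstar.

End FreeBanachLattice.

Arguments HE {R} E.
Arguments HpE {R} E p.
Arguments FBL {R} E p.
Arguments IE {R} E.
Arguments HE_wstar {R} E.
Arguments IE_wstar {R} E.

(* Main.v *)
From HB Require Import structures.
Require Import Defs.
From mathcomp Require Import all_boot all_order all_algebra perm.
From mathcomp Require Import all_classical all_reals all_analysis.
From mathcomp Require Import ring lra.

Set Implicit Arguments.
Unset Strict Implicit.
Unset Printing Implicit Defensive.

Import Order.TTheory GRing.Theory Num.Theory.
Import numFieldNormedType.Exports.
Local Open Scope classical_set_scope.
Local Open Scope ring_scope.

(** The function showing that the inclusion fails is built as follows.

    Let [pi] be the quotient map of [E] onto an infinite-dimensional separable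
    space [V].  By the Dvoretzky-Rogers lemma every infinite-dimensional dual
    contains, for each [n], [n ^ 2] functionals of norm bounded below whose
    absolute values at every point of the unit ball add up to at most [n]
    ([summing_block]); they can moreover be taken to annihilate any finite set.
    Using a dense sequence in [V] and composing with [pi], one obtains blocks
    [phi m] of functionals on [E], of size [(m + 1) ^ 2], which annihilate a
    vector [e] and become small at every fixed vector ([vanishing_blocks]).

    Fix a functional [e'] with [e' e = 1] and let [r = (m + 1) ^ (- 1 / p)].
    The functionals [r ^ 2 / 4 * e' + r / 4 * phi m j] have weak p-norm at most
    1, and so has the constant family [r ^ 2 / 4 * e'] with [(m + 1) ^ 2]
    members.  A lattice expression in finitely many evaluations has
    asymptotically the same values on both families, because [phi m] vanishes in
    the limit.  This property passes to limits in the free Banach lattice norm,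
    so every element of [FBL E p] has it ([FBL_asymptotically_constant]).

    The perturbation [r / 4 * phi m j] is nevertheless larger, by the unbounded
    factor [1 / r], than the multiple of [e'] that it perturbs.  A supremum of
    bumps can therefore equal [|xs e|] on all test functionals with [m] large
    and still vanish at [e'], with the [m]-th bumps bounded by a multiple of
    [r] on the dual ball: the supremum is then weak-star continuous there, as a
    uniform limit ([witness_wstar_continuous]).  It is dominated by the
    evaluation at [e], hence belongs to [IE_wstar E], and it is not
    asymptotically constant.

    That [FBL E p] lies in the closure of [IE_wstar E] holds because this
    closure is a closed sublattice containing the evaluations
    ([FBL_sub_closure]).

    Two classical theorems are proved on the way.  The Hahn-Banach theorem is
    derived from the fact that a minimal sublinear functional is linear.  The
    Dvoretzky-Rogers lemma follows from a choice of a linear map from the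
    Euclidean ball to the unit ball with almost maximal determinant. *)

(** * Norming functionals *)

Section HahnBanach.
Context {R : realType} (V : normedModType R).
Implicit Types (p : V -> R) (x y : V).

(** Sublinear functionals below the norm.  Asking homogeneity only as an
    inequality for positive scalars is enough: the reverse inequality is the
    one for the inverse scalar. *)
Definition sublinear_le_norm p : Prop :=
  [/\ forall x y, p (x + y) <= p x + p y,
      forall (t : R) x, 0 < t -> p (t *: x) <= t * p x &
      forall x, p x <= `|x|].

Lemma sublinear0 p : sublinear_le_norm p -> p 0 = 0.
Proof.
move=> [_ pZ _].
have := pZ 2 0 (ltr0Sn _ 1); have := pZ 2^-1 0; rewrite !scaler0 invr_gt0 ltr0Sn.
by move=> /(_ isT) h1 h2; apply/eqP; rewrite eq_le; apply/andP; split; lra.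
Qed.

Lemma sublinearZ p : sublinear_le_norm p ->
  forall (t : R) x, 0 <= t -> p (t *: x) = t * p x.
Proof.
move=> sp t x; rewrite le_eqVlt => /predU1P[<-|t0].
  by rewrite scale0r mul0r sublinear0.
have [_ pZ _] := sp; apply/eqP; rewrite eq_le pZ//=.
rewrite -ler_pdivlMl//; have := pZ t^-1 (t *: x).
by rewrite invr_gt0 scalerK ?gt_eqF//; exact.
Qed.

Lemma sublinear_ge p x : sublinear_le_norm p -> - `|x| <= p x.
Proof.
move=> sp; have [pD _ pn] := sp.
have := pD x (- x); rewrite subrr sublinear0// => h.
by have := pn (- x); rewrite normrN; lra.
Qed.

(** The greatest sublinear functional below [p] that is additive in the
    direction of [y]. *)
Definition flatten p y x : R :=
  inf [set p (x + t *: y) - t * p y | t in [set t : R | 0 <= t]].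

Lemma flatten_le p y x t : sublinear_le_norm p -> 0 <= t ->
  flatten p y x <= p (x + t *: y) - t * p y.
Proof.
move=> sp t0; have [pD _ _] := sp; apply: ge_inf; last by exists t.
exists (- p (- x)) => _ [s s0 <-]; rewrite -sublinearZ//.
by have := pD (x + s *: y) (- x); rewrite addrAC subrr add0r; lra.
Qed.

Lemma le_flatten p y x m :
  (forall t, 0 <= t -> m <= p (x + t *: y) - t * p y) -> m <= flatten p y x.
Proof.
move=> h; apply: lb_le_inf => [|_ [t t0 <-]]; last exact: h.
by exists (p (x + 0 *: y) - 0 * p y), 0 => //=.
Qed.

Lemma flatten_ler p y x : sublinear_le_norm p -> flatten p y x <= p x.
Proof.
by move=> sp; have := flatten_le y x sp (lexx 0); rewrite scale0r addr0 mul0r subr0.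
Qed.

Lemma sublinear_flatten p y : sublinear_le_norm p -> sublinear_le_norm (flatten p y).
Proof.
move=> sp; have [pD pZ pn] := sp; split=> [x z|t x t0|x].
- rewrite -lerBlDr; apply: le_flatten => s s0.
  rewrite lerBlDl -lerBlDr; apply: le_flatten => t t0.
  have := flatten_le y (x + z) sp (addr_ge0 s0 t0).
  have := pD (x + s *: y) (z + t *: y); rewrite addrACA -scalerDl; lra.
- rewrite -ler_pdivrMl//; apply: le_flatten => s s0; rewrite ler_pdivrMl//.
  apply: le_trans (flatten_le _ _ sp (mulr_ge0 (ltW t0) s0)) _.
  by rewrite -scalerA -scalerDr mulrBr mulrA lerB// pZ.
- exact: le_trans (flatten_ler _ _ sp) (pn x).
Qed.

Lemma sublinear_norm : sublinear_le_norm (fun x => `|x|).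
Proof.
split=> [x y|t x t0|x //]; first exact: ler_normD.
by rewrite normrZ gtr0_norm.
Qed.

(** The pointwise infimum of a chain of sublinear functionals is sublinear, and
    finite because they all exceed the opposite of the norm. *)
Lemma minimal_sublinear p0 : sublinear_le_norm p0 ->
  exists p, [/\ sublinear_le_norm p, forall x, p x <= p0 x &
    forall q, sublinear_le_norm q -> (forall x, q x <= p x) -> q = p].
Proof.
move=> sp0.
pose T := {p | sublinear_le_norm p /\ forall x, p x <= p0 x}.
pose r (s t : T) : bool := `[< forall x, sval t x <= sval s x >].
have [|u v w /asboolP uv /asboolP vw|A totA|[p [sp pp0]] pmin] :=
    @ZL_preorder T (exist _ p0 (conj sp0 (fun x => lexx _))) r.
- by move=> t; apply/asboolP.
- by apply/asboolP => x; exact: le_trans (vw x) (uv x).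
- have [[q0 Aq0]|A0] := pselect (exists q, A q); last first.
    by exists (exist _ p0 (conj sp0 (fun x => lexx _))) => q Aq; exfalso; apply: A0; exists q.
  pose m x := inf [set sval q x | q in A].
  have mle q x : A q -> m x <= sval q x.
    move=> Aq; apply: ge_inf; last by exists q.
    by exists (- `|x|) => _ [u Au <-]; apply: sublinear_ge; case: (svalP u).
  have lem c x : (forall q, A q -> c <= sval q x) -> c <= m x.
    move=> h; apply: lb_le_inf => [|_ [q Aq <-]]; last exact: h.
    by exists (sval q0 x), q0.
  have sm : sublinear_le_norm m /\ forall x, m x <= p0 x.
    split; last first.
      by move=> x; apply: le_trans (mle _ _ Aq0) _; case: (svalP q0).
    split=> [x y|t x t0|x].
    + rewrite -lerBlDr; apply: (lem) => q Aq; rewrite lerBlDl -lerBlDr.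
      apply: (lem) => u Au; rewrite lerBlDl.
      have [/asboolP qu|/asboolP uq] := totA _ _ Aq Au.
      * have [[uD _ _] _] := svalP u.
        apply: le_trans (mle _ _ Au) (le_trans (uD _ _) _).
        by rewrite lerD2r.
      * have [[qD _ _] _] := svalP q.
        apply: le_trans (mle _ _ Aq) (le_trans (qD _ _) _).
        by rewrite lerD2l.
    + rewrite -ler_pdivrMl//; apply: (lem) => q Aq; rewrite ler_pdivrMl//.
      have [[_ qZ _] _] := svalP q.
      exact: le_trans (mle _ _ Aq) (qZ _ _ t0).
    + apply: le_trans (mle _ _ Aq0) _.
      by have [[_ _ +] _] := svalP q0; apply.
  by exists (exist _ m sm) => q Aq; apply/asboolP => x; exact: mle.
exists p; split => // q sq qp.
have q0 x : q x <= p0 x by exact: le_trans (qp x) (pp0 x).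
have := pmin (exist _ q (conj sq q0)); rewrite /r/= => h.
apply/funext => x; apply/eqP; rewrite eq_le qp/=.
suff /asboolP : `[< forall x, p x <= q x >] by [].
by apply: h; apply/asboolP.
Qed.

(** Hahn-Banach theorem, in the form that every vector has a norming
    functional: a minimal sublinear functional is linear. *)
Lemma norming_functional x0 : exists f : V -> R,
  [/\ linear (f : V -> R^o), forall x, `|f x| <= `|x| & f x0 = `|x0| ].
Proof.
(* Flattening the norm along [x0] forces the value at [x0]. *)
have [p [sp pp0 pmin]] := minimal_sublinear (sublinear_flatten x0 sublinear_norm).
have [pD pZ pn] := sp.
have pA x y : p (x + y) = p x + p y.
  apply/eqP; rewrite eq_le pD/=.
  have -> : p x = flatten p y x.
    rewrite (pmin _ (sublinear_flatten y sp))// => z; exact: flatten_ler.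
  by have := flatten_le y x sp ler01; rewrite scale1r mul1r; lra.
have pN x : p (- x) = - p x.
  by apply/eqP; rewrite -addr_eq0 -pA addNr sublinear0.
have pl x : - p x <= `|x| by rewrite -pN -normrN.
exists p; split=> [t x y|x|].
- rewrite pA; congr (_ + _); rewrite /GRing.scale/=.
  have [t0|t0] := leP 0 t; first exact: sublinearZ.
  have : p ((- t) *: x) = (- t) * p x by rewrite sublinearZ// oppr_ge0 ltW.
  by rewrite scaleNr pN mulNr => /oppr_inj.
- by rewrite ler_norml -{1}[`|x|]normrN; have := pl x; rewrite normrN pn andbT lerNl.
- apply/eqP; rewrite eq_le pn/=; have := pp0 (- x0).
  have := @flatten_le _ x0 (- x0) 1 sublinear_norm ler01.
  by rewrite scale1r mul1r addNr normr0 pN; lra.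
Qed.

End HahnBanach.

(** * Functionals on a normed space *)

Section DualElements.
Context {R : realType} {V : normedModType R}.
Implicit Types (f g : dual_space V) (x y : V).

Lemma dual0E x : (0 : dual_space V) x = 0.
Proof. by rewrite /dual_fun raddf0. Qed.

Lemma dualDE f g x : (f + g : dual_space V) x = f x + g x.
Proof. by rewrite /dual_fun raddfD. Qed.

Lemma dualZE (a : R) f x : (a *: f : dual_space V) x = a * f x.
Proof. by rewrite /dual_fun linearZ. Qed.

Lemma dual_sumE (I : finType) (c : I -> R) (f : I -> dual_space V) x :
  (\sum_i c i *: f i : dual_space V) x = \sum_i c i * f i x.
Proof.
apply: (big_ind2 (fun (g : dual_space V) (s : R) => g x = s)).
- exact: dual0E.
- by move=> g1 s1 g2 s2 <- <-; exact: dualDE.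
- by move=> i _; exact: dualZE.
Qed.

Lemma dual_linear f : linear (f : V -> R^o).
Proof. by have /asboolP[] := valP f. Qed.

Lemma dual_D f x y : f (x + y) = f x + f y.
Proof. by have := dual_linear f 1 x y; rewrite !scale1r. Qed.

Lemma dual_0 f : f 0 = 0.
Proof. by apply: (addrI (f 0)); rewrite -dual_D !addr0. Qed.

Lemma dual_Z f (a : R) x : f (a *: x) = a * f x.
Proof. by have := dual_linear f a x 0; rewrite !addr0 dual_0 addr0. Qed.

Lemma dual_B f x y : f (x - y) = f x - f y.
Proof. by rewrite dual_D -scaleN1r dual_Z mulN1r. Qed.

Lemma dual_bounded f : exists2 M : R, 0 < M & forall x, `|f x| <= M * `|x|.
Proof.
have /asboolP[lf cf] := valP f.
pose lmf := GRing.isLinear.Build R V R^o _ (\val f) lf.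
pose F : {linear V -> R^o} := HB.pack (\val f) lmf.
have /linear_boundedP/pinfty_ex_gt0[M M0 fM] : bounded_near F (nbhs (0 : V)).
  by apply: continuous_linear_bounded; exact: cf.
by exists M.
Qed.

Lemma dual_of_bounded (f : V -> R) (M : R) : linear (f : V -> R^o) ->
  (forall x, `|f x| <= M * `|x|) -> exists g : dual_space V, forall x, g x = f x.
Proof.
move=> lf fM.
pose lmf := GRing.isLinear.Build R V R^o _ f lf.
pose F : {linear V -> R^o} := HB.pack f lmf.
have cf : continuous (f : V -> R^o).
  apply: (@bounded_linear_continuous _ _ _ F).
  apply/linear_boundedP; near=> r => x.
  by apply: le_trans (fM x) _; rewrite ler_wpM2r//; near: r; exists M; split=> [|z /ltW]; rewrite ?num_real.
have fd : (f : V -> R^o) \in @dual_pred R V by apply/asboolP.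
by exists (Sub (f : V -> R^o) fd : dual_space V) => x; rewrite /dual_fun SubK.
Unshelve. all: by end_near. Qed.

Lemma dual_separates x : x != 0 -> exists f : dual_space V, f x = 1.
Proof.
move=> x0; have [f [lf fn fx]] := norming_functional x.
have [|g gf] := dual_of_bounded (M := 1) lf; first by move=> z; rewrite mul1r.
exists (`|x|^-1 *: g); rewrite dualZE gf fx mulVf//.
by rewrite normr_eq0.
Qed.

(** A vector outside the span of finitely many vectors is separated from it. *)
Lemma dual_separates_span m (v : 'I_m -> V) x :
  (forall c : 'I_m -> R, x <> \sum_i c i *: v i) ->
  exists f : dual_space V, f x = 1 /\ forall i, f (v i) = 0.
Proof.
elim: m v x => [|m IH] v x xv.
  have [|f fx] := @dual_separates x; last by exists f; split=> // -[].
  by apply/eqP => x0; apply: (xv (fun=> 0)); rewrite big_ord0.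
pose v' i := v (lift ord_max i); pose vm := v ord_max.
have sumE (c : 'I_m -> R) a : \sum_i c i *: v' i + a *: vm =
    \sum_i (if unlift ord_max i is Some j then c j else a) *: v i.
  rewrite (bigD1_ord ord_max)//= unlift_none addrC; congr (_ + _).
  by apply: eq_bigr => i _; rewrite liftK.
have [[c vmc]|vmN] := pselect (exists c : 'I_m -> R, vm = \sum_i c i *: v' i).
  have [c' xc'|f [fx fv]] := IH v' x.
    by apply: (xv _ (etrans _ (sumE c' 0))); rewrite scale0r addr0.
  exists f; split=> // i; case: (unliftP ord_max i) => [j ->|->]; first exact: fv.
  rewrite -/vm vmc; elim/big_ind: _ => [|y z fy fz|j _]; first exact: dual_0.
    by rewrite dual_D fy fz addr0.
  by rewrite dual_Z fv mulr0.
have [c vmc|g [gvm gv]] := IH v' vm; first by apply: vmN; exists c.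
(* Subtracting a multiple of [g] from [f] corrects the value at [vm]; it leaves
   the value at [x] equal to 1 because [f] is normalised at [x - g x *: vm]. *)
have [c xc|f [fx fv]] := IH v' (x - g x *: vm).
  by apply: (xv _ (etrans _ (sumE c (g x)))); rewrite -xc subrK.
exists (f - f vm *: g); split=> [|i].
  by rewrite -scaleN1r dualDE !dualZE mulN1r mulrC -dual_Z -dual_B.
rewrite -scaleN1r dualDE !dualZE.
case: (unliftP ord_max i) => [j ->|->]; first by rewrite fv gv !mulr0 addr0.
by rewrite gvm mulr1 mulN1r subrr.
Qed.

(** In infinite dimensions there are biorthogonal systems of any size whose
    functionals annihilate finitely many prescribed vectors. *)
Lemma biorthogonal_system m (d : 'I_m -> V) N : ~ finite_dimensional V ->
  exists (f : 'I_N -> dual_space V) (y : 'I_N -> V),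
    (forall i k, f i (y k) = (i == k)%:R) /\ forall i l, f i (d l) = 0.
Proof.
move=> Vinf; elim: N => [|N [f [y [fy fd]]]].
  by exists (fun=> 0), (fun=> 0); split=> -[].
pose v (i : 'I_(m + N)) := match fintype.split i with inl l => d l | inr k => y k end.
have [z zv] : exists z, forall c : 'I_(m + N) -> R, z <> \sum_i c i *: v i.
  apply: contrapT => h; apply: Vinf; exists (m + N)%N, v => x.
  apply: contrapT => xv; apply: h; exists x => c xc; apply: xv; by exists c.
have [g [gz gv]] := dual_separates_span zv.
have gd l : g (d l) = 0.
  by rewrite -(gv (unsplit (inl l))) /v unsplitK.
have gy k : g (y k) = 0.
  by rewrite -(gv (unsplit (inr k))) /v unsplitK.
pose f' (i : 'I_N.+1) := if unlift ord_max i is Some j then f j - f j z *: g else g.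
pose y' (i : 'I_N.+1) := if unlift ord_max i is Some j then y j else z.
exists f', y'; split=> [i k|i l]; rewrite /f' /y'.
- case: (unliftP ord_max i) => [i' ->|->];
    case: (unliftP ord_max k) => [k' ->|->].
  + by rewrite -scaleN1r dualDE !dualZE gy !mulr0 addr0 fy (inj_eq lift_inj).
  + rewrite -scaleN1r dualDE !dualZE gz mulr1 mulN1r subrr.
    by rewrite eq_sym (negbTE (neq_lift _ _)).
  + by rewrite gy (negbTE (neq_lift _ _)).
  + by rewrite gz eqxx.
- case: (unliftP ord_max i) => [i' _|_] //.
  by rewrite -scaleN1r dualDE !dualZE fd gd !mulr0 addr0.
Qed.

End DualElements.

(** * The Dvoretzky-Rogers lemma *)

Section DvoretzkyRogers.
Context {R : realType}.

(** The square of the Euclidean norm. *)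
Definition sqnorm n (a : 'rV[R]_n) : R := (a *m a^T) 0 0.

Lemma sqnormE n (a : 'rV[R]_n) : sqnorm a = \sum_i a 0 i ^+ 2.
Proof. by rewrite /sqnorm mxE; apply: eq_bigr => i _; rewrite mxE. Qed.

Lemma sqnorm_ge0 n (a : 'rV[R]_n) : 0 <= sqnorm a.
Proof. by rewrite sqnormE; apply: sumr_ge0 => i _; exact: sqr_ge0. Qed.

Lemma sqnormZ n (t : R) (a : 'rV[R]_n) : sqnorm (t *: a) = t ^+ 2 * sqnorm a.
Proof.
by rewrite !sqnormE mulr_sumr; apply: eq_bigr => i _; rewrite mxE exprMn.
Qed.

Lemma sqnorm_eq0 n (a : 'rV[R]_n) : (sqnorm a == 0) = (a == 0).
Proof.
apply/idP/eqP => [|->]; last by rewrite /sqnorm mul0mx mxE.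
rewrite sqnormE psumr_eq0 => [/allP h|i _]; last exact: sqr_ge0.
apply/rowP => i; apply/eqP; rewrite mxE -sqrf_eq0.
by apply: h; rewrite mem_index_enum.
Qed.

Lemma coord_le_sqnorm n (a : 'rV[R]_n) i : sqnorm a <= 1 -> `|a 0 i| <= 1.
Proof.
rewrite sqnormE (bigD1 i)//= => h; rewrite -(@expr_le1 _ 2)// real_normK ?num_real//.
by apply: le_trans h; rewrite lerDl; apply: sumr_ge0 => j _; exact: sqr_ge0.
Qed.

(** [2 - B^T B] is [1 + P] for the orthogonal projection [P] onto the
    complement of the span of the rows of [B]; both sides compute the
    determinant of the block matrix with rows [1, B] and [B^T, 2]. *)
Lemma det_orthonormal_complement j n (B : 'M[R]_(j, n)) : B *m B^T = 1%:M ->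
  2 ^+ j * \det (2%:M - B^T *m B) = 2 ^+ n.
Proof.
move=> BB; pose M := block_mx 1%:M B B^T 2%:M.
have M1 : \det M = \det (2%:M - B^T *m B).
  have := congr1 (@determinant R _) (mulmx_block 1%:M 0 (- B^T) 1%:M 1%:M B B^T 2%:M).
  rewrite det_mulmx det_lblock !det1 !mul1r -/M => ->.
  rewrite !mul1mx !mul0mx !addr0 !mulmx1 addNr det_ublock det1 mul1r.
  by rewrite mulNmx addrC.
have M2 : \det M = \det (2^-1%:M : 'M[R]_j) * \det (2%:M : 'M[R]_n).
  have := congr1 (@determinant R _)
    (mulmx_block 1%:M B B^T 2%:M 1%:M 0 (- (2^-1 *: B^T)) 1%:M).
  rewrite det_mulmx det_lblock !det1 !mulr1 -/M => ->.
  rewrite !mulmx1 !mulmx0 !add0r !mulmxN -!scalemxAr BB.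
  rewrite mul_scalar_mx scalerA mulVf ?pnatr_eq0// scale1r subrr det_ublock.
  congr (\det _ * _); rewrite scale_scalar_mx mulr1.
  by apply/matrixP => a b; rewrite !mxE -mulrnBl; congr (_ *+ _); lra.
rewrite -M1 M2 !det_scalar mulrA -exprMn mulfV ?pnatr_eq0//.
by rewrite expr1n mul1r.
Qed.

Section Norm.
Context (N : nat) (nu : 'rV[R]_N -> R) (C : R).
Hypothesis nuD : forall a b : 'rV[R]_N, nu (a + b) <= nu a + nu b.
Hypothesis nuZ : forall (t : R) (a : 'rV[R]_N), nu (t *: a) = `|t| * nu a.
Hypothesis nu_coord : forall (a : 'rV[R]_N) j, `|a 0 j| <= C * nu a.

(** [u] maps the Euclidean ball into the unit ball of [nu]. *)
Let contraction (u : 'M[R]_N) := forall a : 'rV[R]_N, sqnorm a <= 1 -> nu (a *m u) <= 1.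

(** Near-maximisers of these determinants are used, so only boundedness and
    not attainment of the supremum matters. *)
Let dets : set R := [set `|\det u| | u in contraction].

Let nu0 : nu 0 = 0.
Proof. by rewrite -(scale0r 0) nuZ normr0 mul0r. Qed.

Let nu_ge0 (a : 'rV[R]_N) : 0 <= nu a.
Proof.
have := nuD a ((-1) *: a); rewrite nuZ normrN1 mul1r scaleN1r subrr nu0; lra.
Qed.

Let nu_sum n (x : 'I_n -> 'rV[R]_N) :
  nu (\sum_i x i) <= \sum_i nu (x i).
Proof.
apply: (big_ind2 (fun a (s : R) => nu a <= s)) => [|a s b t as_ bt|//].
  by rewrite nu0.
exact: le_trans (nuD _ _) (lerD as_ bt).
Qed.

Let dets_bounded : has_ubound dets.
Proof.
pose K := Num.max C 0.
exists (\sum_(s : 'S_N) K ^+ N) => _ [u cu <-].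
apply: le_trans (ler_norm_sum _ _ _) _; apply: ler_sum => s _.
rewrite normrM normrX normrN1 expr1n mul1r normr_prod.
have -> : K ^+ N = \prod_(i < N) K by rewrite prodr_const card_ord.
apply: ler_prod => i _; rewrite normr_ge0/=.
have -> : u i (s i) = ((delta_mx 0 i : 'rV_N) *m u) 0 (s i) by rewrite -rowE mxE.
apply: le_trans (nu_coord _ _) _.
have nu1 : nu ((delta_mx 0 i : 'rV_N) *m u) <= 1.
  apply: cu; rewrite sqnormE (bigD1 i)//= big1 => [|k ki].
    by rewrite mxE !eqxx/= addr0 expr1n.
  by rewrite mxE (negbTE ki) andbF expr0n.
apply: (@le_trans _ _ (K * nu ((delta_mx 0 i : 'rV_N) *m u))).
  by rewrite ler_wpM2r// le_max lexx.
by rewrite ler_piMr// le_max lexx orbT.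
Qed.

Let dets_pos : exists2 u, contraction u & 0 < `|\det u|.
Proof.
pose S := 1 + \sum_(i < N) nu (delta_mx 0 i).
have S0 : 0 < S by rewrite ltr_wpDr// sumr_ge0.
exists (S^-1)%:M; last by rewrite det_scalar normr_gt0 expf_neq0// invr_eq0 gt_eqF.
move=> a a1; rewrite mul_mx_scalar nuZ gtr0_norm ?invr_gt0// ler_pdivrMl// mulr1.
rewrite [a]row_sum_delta; apply: le_trans (nu_sum _) _.
apply: (@le_trans _ _ (\sum_(i < N) nu (delta_mx 0 i))); last by rewrite lerDr.
by apply: ler_sum => i _; rewrite nuZ ler_piMl// coord_le_sqnorm.
Qed.

Let D := sup dets.

Let det_le (r : R) (u : 'M[R]_N) : 0 < r ->
  (forall a : 'rV[R]_N, sqnorm a <= 1 -> nu (a *m u) <= r) -> `|\det u| <= r ^+ N * D.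
Proof.
move=> r0 ur; have -> : u = r *: (r^-1 *: u) by rewrite scalerA mulfV ?scale1r ?gt_eqF.
rewrite detZ normrM normrX gtr0_norm// ler_pM2l ?exprn_gt0//.
apply: ub_le_sup => //; exists (r^-1 *: u) => // a a1.
by rewrite -scalemxAr nuZ gtr0_norm ?invr_gt0// ler_pdivrMl// mulr1 ur.
Qed.

(** For an operator of almost maximal determinant, every subspace of at least
    half the dimension contains a Euclidean unit vector with a large image:
    otherwise stretching that subspace would increase the determinant. *)
Lemma large_image k j (u : 'M[R]_N) (B : 'M[R]_(j, N)) :
  (0 < k)%N -> N = (2 * k)%N -> (j <= k)%N ->
  contraction u -> 7 / 8 * D < `|\det u| -> B *m B^T = 1%:M ->
  exists a : 'rV[R]_N, [/\ a *m B^T = 0, sqnorm a = 1 & 1 / 4 <= nu (a *m u)].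
Proof.
move=> k0 Nk jk cu uD BB.
have [[a [aB a1 nua]]|noa] := pselect (exists a : 'rV[R]_N,
    [/\ a *m B^T = 0, sqnorm a <= 1 & 1 / 4 < nu (a *m u)]).
  have sa0 : 0 < sqnorm a.
    rewrite lt_neqAle sqnorm_ge0 eq_sym sqnorm_eq0 andbT.
    by apply: contraTneq nua => ->; rewrite mul0mx nu0 -leNgt.
  have q0 : 0 < Num.sqrt (sqnorm a) by rewrite sqrtr_gt0.
  exists ((Num.sqrt (sqnorm a))^-1 *: a); split.
  - by rewrite -scalemxAl aB scaler0.
  - by rewrite sqnormZ exprVn sqr_sqrtr ?sqnorm_ge0// mulVf// gt_eqF.
  - rewrite -scalemxAl nuZ gtr0_norm ?invr_gt0// ler_pdivlMl//.
    apply: le_trans (ltW nua); rewrite ler_piMl//.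
    by rewrite -sqrtr1 ler_wsqrtr.
exfalso.
(* [P] is the orthogonal projection onto the complement of the rows of [B]. *)
pose P := 1%:M - B^T *m B.
have PB : P *m B^T = 0 by rewrite mulmxBl mul1mx -mulmxA BB mulmx1 subrr.
have PP : P *m P^T = P.
  rewrite {2}/P linearB/= trmx1 trmx_mul trmxK mulmxBr mulmx1 mulmxA PB.
  by rewrite mul0mx subr0.
have Psq (b : 'rV_N) : sqnorm (b *m P) <= sqnorm b.
  have -> : sqnorm (b *m P) = sqnorm b - sqnorm (b *m B^T).
    rewrite /sqnorm !trmx_mul !trmxK !mulmxA -(mulmxA b) PP mulmxBr mulmx1.
    by rewrite mulmxBl !mulmxA [LHS]mxE [X in _ + X]mxE.
  by rewrite gerBl sqnorm_ge0.
have uP (a : 'rV_N) : sqnorm a <= 1 -> nu (a *m ((2%:M - B^T *m B) *m u)) <= 5 / 4.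
  move=> a1.
  have -> : a *m ((2%:M - B^T *m B) *m u) = a *m u + a *m P *m u.
    rewrite -mulmxA -mulmxDr; congr (_ *m _).
    rewrite -{2}[u]mul1mx -mulmxDl addrA; congr ((_ - _) *m _).
    by apply/matrixP => b c; rewrite !mxE -mulrnDl; congr (_ *+ _); lra.
  apply: le_trans (nuD _ _) _.
  have : nu (a *m P *m u) <= 1 / 4.
    rewrite leNgt; apply/negP => h; apply: noa; exists (a *m P); split=> //.
      by rewrite -mulmxA PB mulmx0.
    exact: le_trans (Psq _) a1.
  have := cu _ a1; lra.
have detB := det_orthonormal_complement BB.
have := det_le _ uP; rewrite divr_gt0// => /(_ isT).
rewrite det_mulmx normrM.
have D0 : 0 < D.
  have [v cv v0] := dets_pos; apply: lt_le_trans v0 _.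
  by apply: ub_le_sup => //; exists v.
have MK : 2 ^+ k <= `|\det (2%:M - B^T *m B)|.
  have : 2 ^+ j * 2 ^+ k <= (2 ^+ j * `|\det (2%:M - B^T *m B)| : R).
    rewrite -{2}[2 ^+ j]ger0_norm ?exprn_ge0// -normrM detB ger0_norm ?exprn_ge0//.
    rewrite -exprD ler_weXn2l ?ler1n// Nk mul2n -addnn leq_add2r //.
  by rewrite ler_pM2l ?exprn_gt0.
(* [(1 + P) u] has norm at most 5/4, while the factor gained by the determinant
   is at least [2 ^ k] with [N = 2 k] and [(5/4) ^ 2 < 2]; since [25/32 < 7/8],
   this contradicts the near-maximality of [u]. *)
have h54 : (5 / 4) ^+ N <= (25 / 32 * 2 ^+ k : R).
  rewrite Nk exprM; have -> : (5 / 4) ^+ 2 = 25 / 32 * 2 :> R by lra.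
  rewrite exprMn ler_pM2r ?exprn_gt0// -(prednK k0) exprS.
  by rewrite ler_piMr ?exprn_ile1//; lra.
apply/negP; rewrite -ltNge.
apply: (@le_lt_trans _ _ (25 / 32 * 2 ^+ k * D)); first by rewrite ler_pM2r.
apply: (@lt_le_trans _ _ (2 ^+ k * `|\det u|)); last by rewrite ler_wpM2r.
by rewrite [25 / 32 * _]mulrC -mulrA ltr_pM2l ?exprn_gt0//; lra.
Qed.

(** Half as many vectors as the dimension, of norm at least 1/4, all of whose
    combinations with coefficients in the Euclidean ball have norm at most 1. *)
Lemma dvoretzky_rogers k : N = (2 * k)%N ->
  exists x : 'I_k -> 'rV[R]_N, (forall i, 1 / 4 <= nu (x i)) /\
    forall c : 'I_k -> R, \sum_i c i ^+ 2 <= 1 -> nu (\sum_i c i *: x i) <= 1.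
Proof.
case: (posnP k) => [-> _|k0 Nk].
  exists (fun=> 0); split=> [[]//|c _]; by rewrite big_ord0 nu0.
have [u cu uD] : exists2 u, contraction u & 7 / 8 * D < `|\det u|.
  have [v cv v0] := dets_pos.
  have hs : has_sup dets by split=> //; exists `|\det v|, v.
  have D0 : 0 < D by apply: lt_le_trans v0 _; apply: ub_le_sup => //; exists v.
  have [|_ [u cu <-] h] := @sup_adherent _ dets (D / 8) _ hs; first by rewrite divr_gt0.
  by exists u => //; apply: le_lt_trans h; rewrite -/D; lra.
have [B [BB Bnu]] : exists B : 'M[R]_(k, N),
    B *m B^T = 1%:M /\ forall i, 1 / 4 <= nu (row i B *m u).
  have : (k <= k)%N by [].
  elim: {-2}k => [|j IH] jk.
    by exists 0; split=> [|[]//]; apply/matrixP => -[].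
  have [B [BB Bnu]] := IH (ltnW jk).
  have [a [aB a1 nua]] := large_image k0 Nk (ltnW jk) cu uD BB.
  rewrite -addn1; exists (col_mx B a); split.
    rewrite tr_col_mx mul_col_row BB aB.
    have -> : B *m a^T = 0 by rewrite -[LHS]trmxK trmx_mul trmxK aB trmx0.
    rewrite scalar_mx_block; congr block_mx.
    by apply/matrixP => i l; rewrite !ord1 [LHS]a1 mxE.
  move=> i; case: (splitP i) => l il.
    have -> : i = lshift 1 l by apply/val_inj.
    by rewrite rowKu.
  have -> : i = rshift j l by apply/val_inj.
  by rewrite rowKd row_id.
exists (fun i => row i B *m u); split=> // c c1.
have -> : \sum_i c i *: (row i B *m u) = (\row_i c i) *m B *m u.
  rewrite (mulmx_sum_row _ B) mulmx_suml; apply: eq_bigr => i _.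
  by rewrite mxE scalemxAl.
apply: cu; rewrite /sqnorm trmx_mul mulmxA -(mulmxA _ B) BB mulmx1.
by rewrite -/(sqnorm _) sqnormE; under eq_bigr do rewrite mxE.
Qed.

End Norm.
End DvoretzkyRogers.

(** * Blocks of functionals with small weak sums *)

Section Blocks.
Context {R : realType} {V : normedModType R}.

Lemma sum_norm_le_sqrt n (r : 'I_(n * n) -> R) :
  \sum_i r i ^+ 2 <= 1 -> \sum_i `|r i| <= n%:R.
Proof.
case: n r => [|n] r r1; first by rewrite big_ord0.
have n0 : 0 < n.+1%:R :> R by rewrite ltr0n.
rewrite -(ler_pM2l n0) mulr_sumr.
(* Arithmetic-geometric mean inequality for [n |r i|] and 1. *)
apply: (@le_trans _ _ (\sum_i (1 / 2 + 1 / 2 * n.+1%:R ^+ 2 * r i ^+ 2))).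
  apply: ler_sum => i _; have := sqr_ge0 (n.+1%:R * `|r i| - 1).
  by rewrite -[r i ^+ 2]real_normK ?num_real// sqrrB1 exprMn; lra.
rewrite big_split/= sumr_const card_ord -mulr_sumr -[(1 / 2) *+ _]mulr_natr natrM.
have : n.+1%:R ^+ 2 * \sum_i r i ^+ 2 <= n.+1%:R ^+ 2 :> R.
  by rewrite ler_piMr ?exprn_ge0.
rewrite !expr2; set S := \sum_i _; lra.
Qed.

(** The norm of a functional as a real number. *)
Definition functional_norm (f : dual_space V) : R :=
  sup [set `|f x| | x in unit_ball V].

Lemma le_functional_norm1 (f : dual_space V) x :
  `|x| <= 1 -> `|f x| <= functional_norm f.
Proof.
move=> x1; have [M M0 fM] := dual_bounded f; apply: ub_le_sup; last by exists x.
exists M => _ [z z1 <-]; apply: le_trans (fM z) _.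
by rewrite ler_piMr// ltW.
Qed.

Lemma functional_norm_le (f : dual_space V) m :
  (forall x, `|x| <= 1 -> `|f x| <= m) -> functional_norm f <= m.
Proof.
move=> fm; apply: ge_sup; last by move=> _ [x x1 <-]; exact: fm.
by exists `|f 0|, 0 => //; rewrite /unit_ball/= normr0.
Qed.

Lemma le_functional_norm (f : dual_space V) x :
  `|f x| <= functional_norm f * `|x|.
Proof.
have [->|x0] := eqVneq x 0; first by rewrite dual_0 !normr0 mulr0.
have nx0 : 0 < `|x| by rewrite normr_gt0.
have := @le_functional_norm1 f (`|x|^-1 *: x).
rewrite dual_Z normrM normrZ normfV normr_id mulVf ?gt_eqF// => /(_ (lexx _)).
by rewrite ler_pdivrMl// mulrC.
Qed.

Lemma functional_normD (f g : dual_space V) :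
  functional_norm (f + g) <= functional_norm f + functional_norm g.
Proof.
apply: functional_norm_le => x x1; rewrite dualDE.
by apply: le_trans (ler_normD _ _) (lerD _ _); exact: le_functional_norm1.
Qed.

Lemma functional_normZ (t : R) (f : dual_space V) :
  functional_norm (t *: f) = `|t| * functional_norm f.
Proof.
have leZ (s : R) (g : dual_space V) : functional_norm (s *: g) <= `|s| * functional_norm g.
  apply: functional_norm_le => x x1; rewrite dualZE normrM.
  by rewrite ler_wpM2l// le_functional_norm1.
apply/eqP; rewrite eq_le leZ/=.
have [->|t0] := eqVneq t 0.
  rewrite normr0 mul0r; apply: le_trans (le_functional_norm1 _ (x := 0) _) => //.
  by rewrite normr0.
rewrite -ler_pdivlMl ?normr_gt0// -normfV.
by rewrite -[X in functional_norm X](scalerK t0) leZ.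
Qed.

Lemma functional_norm_attained (f : dual_space V) (r : R) :
  0 <= r -> r < functional_norm f -> exists2 y, `|y| <= 1 & r <= f y.
Proof.
move=> r0 rf; apply: contrapT => h; move: rf; apply/negP; rewrite -leNgt.
apply: functional_norm_le => x x1; rewrite leNgt; apply/negP => rx; apply: h.
have [fx|fx] := leP 0 (f x); first by exists x => //; rewrite -(ger0_norm fx) ltW.
exists (- x); first by rewrite normrN.
by rewrite -scaleN1r dual_Z mulN1r -(ltr0_norm fx) ltW.
Qed.

(** In an infinite-dimensional space there are [n ^ 2] functionals of norm
    bounded below, annihilating prescribed vectors, whose weak 1-summing norm
    is at most [n]. *)
Lemma summing_block m (d : 'I_m -> V) n : ~ finite_dimensional V ->
  exists (f : 'I_(n * n) -> dual_space V) (y : 'I_(n * n) -> V),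
    [/\ forall i l, f i (d l) = 0,
        forall i, `|y i| <= 1 /\ 1 / 8 <= f i (y i),
        forall x, `|x| <= 1 -> \sum_i `|f i x| <= n%:R &
        forall i x, `|x| <= 1 -> `|f i x| <= 1].
Proof.
move=> Vinf.
have [g [z [gz gd]]] := biorthogonal_system d (2 * (n * n)) Vinf.
pose F (a : 'rV[R]_(2 * (n * n))) : dual_space V := \sum_i a 0 i *: g i.
have FE a x : F a x = \sum_i a 0 i * g i x by exact: dual_sumE.
have FD a b : F (a + b) = F a + F b.
  by rewrite /F -big_split; apply: eq_bigr => i _; rewrite mxE scalerDl.
have FZ (t : R) a : F (t *: a) = t *: F a.
  by rewrite /F scaler_sumr; apply: eq_bigr => i _; rewrite mxE scalerA.
pose nu a := functional_norm (F a).
have nu_coord (a : 'rV_(2 * (n * n))) j : `|a 0 j| <= (\sum_i `|z i|) * nu a.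
  have -> : a 0 j = F a (z j).
    rewrite FE (bigD1 j)//= gz eqxx mulr1 big1 ?addr0// => i ij.
    by rewrite gz (negbTE ij) mulr0.
  apply: le_trans (le_functional_norm _ _) _; rewrite mulrC ler_wpM2r//.
    by apply: le_trans (le_functional_norm1 _ (x := 0) _) => //; rewrite normr0.
  by rewrite (bigD1 j)//= lerDl sumr_ge0.
have [|||x [nux xnu]] := @dvoretzky_rogers R _ nu _ _ _ nu_coord (n * n).
- by move=> a b; rewrite /nu FD functional_normD.
- by move=> t a; rewrite /nu FZ functional_normZ.
- by [].
have /choice[y yP] : forall i, exists y, `|y| <= 1 /\ 1 / 8 <= F (x i) y.
  move=> i.
  have [||u u1 fu] := @functional_norm_attained (F (x i)) (1 / 8); last by exists u.
    by lra.
  by apply: lt_le_trans (nux i); lra.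
exists (fun i => F (x i)), y.
(* Duality with the Euclidean ball: test the combination with coefficients
   proportional to the values at [v]. *)
have sq1 v : `|v| <= 1 -> \sum_i F (x i) v ^+ 2 <= 1.
  move=> v1; set S := \sum_i _.
  have [S0|S0] := leP S 0; first exact: le_trans S0 ler01.
  have q0 : 0 < Num.sqrt S by rewrite sqrtr_gt0.
  have SS : Num.sqrt S ^+ 2 = S by rewrite sqr_sqrtr// ltW.
  pose c i := (Num.sqrt S)^-1 * F (x i) v.
  have c1 : \sum_i c i ^+ 2 <= 1.
    under eq_bigr do rewrite exprMn.
    by rewrite -mulr_sumr -/S exprVn SS mulVf// gt_eqF.
  have := le_trans (le_functional_norm1 (F _) v1) (xnu _ c1).
  have -> : F (\sum_i c i *: x i) = \sum_i c i *: F (x i).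
    apply: (big_ind2 (fun a b => F a = b)) => [|a b a' b' <- <-|i _].
    + by rewrite -(scale0r 0) FZ scale0r.
    + exact: FD.
    + exact: FZ.
  rewrite dual_sumE; under eq_bigr do rewrite -mulrA -expr2.
  rewrite -mulr_sumr -/S.
  have -> : (Num.sqrt S)^-1 * S = Num.sqrt S.
    by rewrite -[X in _ * X]SS expr2 mulKf// gt_eqF.
  by rewrite ger0_norm ?(ltW q0)// => h; rewrite -[leLHS]SS expr_le1 ?(ltW q0).
split=> //.
- move=> i l; rewrite FE big1// => k _; by rewrite gd mulr0.
- by move=> v v1; apply: sum_norm_le_sqrt; exact: sq1.
- move=> i v /sq1; rewrite (bigD1 i)//= => h.
  rewrite -(@expr_le1 _ 2)// real_normK ?num_real//; apply: le_trans h.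
  by rewrite lerDl sumr_ge0// => j _; exact: sqr_ge0.
Qed.

End Blocks.

(** * Closures of sublattices in the free Banach lattice norm *)

Section PowerSums.
Context {R : realType} (p : R).
Hypothesis p1 : 1 <= p.

Let p0 : 0 < p. Proof. exact: lt_le_trans p1. Qed.

(** The [p]-th power of the p-norm of a finite family. *)
Definition power_sum n (u : 'I_n -> R) : R := \sum_(j < n) `|u j| `^ p.

Lemma power_sum_ge0 n (u : 'I_n -> R) : 0 <= power_sum u.
Proof. by apply: sumr_ge0 => j _; exact: powR_ge0. Qed.

Lemma ler_powR_base (a b : R) : 0 <= a -> a <= b -> a `^ p <= b `^ p.
Proof.
move=> a0 ab; apply: ge0_ler_powR => //; first exact: ltW.
by rewrite nnegrE (le_trans a0).
Qed.

Lemma powR_base_le1 (a : R) : 0 <= a -> a <= 1 -> a `^ p <= 1.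
Proof. by move=> a0 a1; have := ler_powR_base a0 a1; rewrite powR1. Qed.

Lemma powR_root_le (S c : R) : 0 <= S -> 0 <= c ->
  (S `^ p^-1 <= c) = (S <= c `^ p).
Proof.
move=> S0 c0; apply/idP/idP => h.
  rewrite -[S]powRr1// -(mulVf (lt0r_neq0 p0)) powRrM.
  by apply: ler_powR_base; rewrite ?powR_ge0.
rewrite -[c]powRr1// -(mulfV (lt0r_neq0 p0)) powRrM.
by apply: ge0_ler_powR; rewrite ?invr_ge0 ?(ltW p0)// nnegrE// powR_ge0.
Qed.

Lemma powR_add_le (a b : R) : 0 <= a -> 0 <= b ->
  (a + b) `^ p <= 2 `^ p * (a `^ p + b `^ p).
Proof.
move=> a0 b0; have m0 : 0 <= Num.max a b by rewrite le_max a0.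
apply: (@le_trans _ _ ((2 * Num.max a b) `^ p)).
  apply: ler_powR_base; first exact: addr_ge0.
  have : a <= Num.max a b by rewrite le_max lexx.
  have : b <= Num.max a b by rewrite le_max lexx orbT.
  lra.
rewrite powRM// ler_wpM2l ?powR_ge0//.
by have [_|_] := leP a b; rewrite ?lerDl ?lerDr powR_ge0.
Qed.

Lemma power_sum_dominated n (f g h : 'I_n -> R) (K : R) : 0 <= K ->
  (forall j, `|h j| <= K * (`|f j| + `|g j|)) ->
  power_sum h <= (2 * K) `^ p * (power_sum f + power_sum g).
Proof.
move=> K0 hfg; rewrite /power_sum -big_split mulr_sumr; apply: ler_sum => j _.
apply: le_trans (ler_powR_base (normr_ge0 _) (hfg j)) _.
rewrite powRM ?addr_ge0// [2 * K]mulrC powRM// -mulrA ler_wpM2l ?powR_ge0//.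
exact: powR_add_le.
Qed.

Lemma power_sum_scale n (f : 'I_n -> R) (K : R) :
  power_sum (fun j => K * f j) = `|K| `^ p * power_sum f.
Proof.
by rewrite /power_sum mulr_sumr; apply: eq_bigr => j _; rewrite normrM powRM.
Qed.

End PowerSums.

Section FreeBanachLatticeNorm.
Context {R : realType} {E : normedModType R} (p : R).
Hypothesis p1 : 1 <= p.
Implicit Types (f g h : dual_space E -> R) (S : set (dual_space E -> R)).

Let p0 : 0 < p. Proof. exact: lt_le_trans p1. Qed.

(** Families of weak p-norm at most 1. *)
Definition weakly_bounded n (xs : 'I_n -> dual_space E) : Prop :=
  forall x : E, `|x| <= 1 -> power_sum p (fun j => xs j x) <= 1.

Lemma weak_pnorm_le1 n (xs : 'I_n -> dual_space E) :
  (weak_pnorm p xs <= 1)%E <-> weakly_bounded xs.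
Proof.
have eq1 x : ((\sum_(j < n) `|xs j x| `^ p) `^ p^-1 <= 1) =
             (power_sum p (fun j => xs j x) <= 1).
  by rewrite powR_root_le// ?powR1//; exact: power_sum_ge0.
split=> [h x x1|h].
  rewrite -eq1 -lee_fin; apply: le_trans h; apply: ereal_sup_ubound.
  by exists x.
by apply: ge_ereal_sup => _ [x x1 <-]; rewrite lee_fin eq1; exact: h.
Qed.

(** The inequality between the free Banach lattice norm of [f] and [c], freed
    of suprema and roots. *)
Definition fbl_bounded (c : R) f : Prop :=
  forall n (xs : 'I_n -> dual_space E), weakly_bounded xs ->
    power_sum p (fun j => f (xs j)) <= c `^ p.

Lemma fbl_norm_le f (c : R) : 0 <= c ->
  (fbl_norm p f <= c%:E)%E <-> fbl_bounded c f.
Proof.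
move=> c0; have eqc n (xs : 'I_n -> dual_space E) :
    ((\sum_(j < n) `|f (xs j)| `^ p) `^ p^-1 <= c) =
    (power_sum p (fun j => f (xs j)) <= c `^ p).
  by rewrite powR_root_le//; exact: power_sum_ge0.
split=> [h n xs xs1|h].
  rewrite -eqc -lee_fin; apply: le_trans h; apply: ereal_sup_ubound.
  by exists n, xs; split=> //; apply/weak_pnorm_le1.
apply: ge_ereal_sup => _ [n [xs [/weak_pnorm_le1 xs1 ->]]].
by rewrite lee_fin eqc; exact: h.
Qed.

Lemma HpEP f : HpE E p f <-> HE E f /\ exists2 c, 0 <= c & fbl_bounded c f.
Proof.
split=> -[fH fb]; split=> //.
  have [c fc] : exists c, (fbl_norm p f <= c%:E)%E.
    by case: (fbl_norm p f) fb => [r| |]// _; [exists r|exists 0; rewrite leNye].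
  exists (Num.max c 0); first by rewrite le_max lexx orbT.
  apply/fbl_norm_le; first by rewrite le_max lexx orbT.
  by apply: le_trans fc _; rewrite lee_fin le_max lexx.
have [c c0 fc] := fb.
have h : (fbl_norm p f <= c%:E)%E by apply/fbl_norm_le.
exact: le_lt_trans h (ltry _).
Qed.

Lemma HpE_closureP S f : HpE_closure p S f <->
  HpE E p f /\ forall e : R, 0 < e ->
    exists2 g, S g & fbl_bounded e (fun xs => f xs - g xs).
Proof.
split=> -[fH fS]; split=> // e e0.
  have [g Sg fg] := fS _ e0; exists g => //.
  by apply/fbl_norm_le; rewrite ltW.
have [|g Sg fg] := fS (e / 2); first by rewrite divr_gt0.
exists g => //; apply: (@le_lt_trans _ _ (e / 2)%:E).
  by apply/fbl_norm_le => //; rewrite divr_ge0// ltW.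
by rewrite lte_fin ltr_pdivrMr//; lra.
Qed.

(** A triangle inequality up to a constant, which is all that arguments on
    closures need. *)
Lemma fbl_bounded_dominated f g h (K a b : R) : 0 <= K -> 0 <= a -> 0 <= b ->
  fbl_bounded a f -> fbl_bounded b g ->
  (forall xs, `|h xs| <= K * (`|f xs| + `|g xs|)) ->
  fbl_bounded (4 * K * (a + b)) h.
Proof.
move=> K0 a0 b0 fa gb hfg n xs xs1.
have := power_sum_dominated p1 K0 (fun j : 'I_n => hfg (xs j)).
move=> /le_trans; apply.
have -> : 4 * K * (a + b) = 2 * K * (2 * (a + b)) by lra.
rewrite [leRHS]powRM ?mulr_ge0 ?addr_ge0// ler_wpM2l ?powR_ge0//.
apply: le_trans (lerD (fa _ _ xs1) (gb _ _ xs1)) _.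
rewrite powRM ?addr_ge0//.
have : a `^ p <= (a + b) `^ p by apply: ler_powR_base => //; rewrite lerDl.
have : b `^ p <= (a + b) `^ p by apply: ler_powR_base => //; rewrite lerDr.
have : 2 * (a + b) `^ p <= 2 `^ p * (a + b) `^ p.
  by rewrite ler_wpM2r ?powR_ge0// le1r_powR// ler1n.
lra.
Qed.

(** Positively homogeneous Lipschitz operations.  They include the linear
    combinations, the maximum, the minimum and the zero operation, so that a
    nonempty set stable under all of them is a sublattice. *)
Definition lattice_op (op : R -> R -> R) : Prop :=
  (forall l a b, 0 <= l -> op (l * a) (l * b) = l * op a b) /\
  exists2 K, 0 <= K &
    forall a b c d, `|op a b - op c d| <= K * (`|a - c| + `|b - d|).

Definition op_stable S : Prop := forall op, lattice_op op ->
  forall f g, S f -> S g -> S (fun xs => op (f xs) (g xs)).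

Lemma lattice_op_zero op : lattice_op op -> op 0 0 = 0.
Proof. by move=> [opZ _]; have := opZ 0 0 0 (lexx _); rewrite !mul0r. Qed.

Lemma lattice_op_le op : lattice_op op -> exists2 K, 0 <= K &
  forall a b, `|op a b| <= K * (`|a| + `|b|).
Proof.
move=> lop; have [_ [K K0 opK]] := lop; exists K => // a b.
by have := opK a b 0 0; rewrite (lattice_op_zero lop) !subr0.
Qed.

Lemma lattice_op_linear (t : R) : lattice_op (fun a b => t * a + b).
Proof.
split=> [l a b _|]; first by rewrite mulrDr mulrCA.
exists (1 + `|t|); first by rewrite addr_ge0.
move=> a b c d; have -> : t * a + b - (t * c + d) = t * (a - c) + (b - d) by lra.
apply: le_trans (ler_normD _ _) _; rewrite normrM.
have := normr_ge0 t; have := normr_ge0 (a - c); have := normr_ge0 (b - d).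
nra.
Qed.

Lemma max_lipschitz (a b c d : R) :
  `|Num.max a b - Num.max c d| <= `|a - c| + `|b - d|.
Proof.
rewrite ler_norml.
have := ler_norm (a - c); have := ler_norm (b - d).
have := ler_norm (c - a); have := ler_norm (d - b).
rewrite (distrC c) (distrC d).
by have [ab|ab] := leP a b; have [cd|cd] := leP c d => *; apply/andP; split; lra.
Qed.

Lemma min_lipschitz (a b c d : R) :
  `|Num.min a b - Num.min c d| <= `|a - c| + `|b - d|.
Proof.
rewrite ler_norml.
have := ler_norm (a - c); have := ler_norm (b - d).
have := ler_norm (c - a); have := ler_norm (d - b).
rewrite (distrC c) (distrC d).
by have [ab|ab] := leP a b; have [cd|cd] := leP c d => *; apply/andP; split; lra.
Qed.

Lemma lattice_op_max : lattice_op Num.max.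
Proof.
split=> [l a b l0|]; first by rewrite maxr_pMr.
by exists 1 => // a b c d; rewrite mul1r max_lipschitz.
Qed.

Lemma lattice_op_min : lattice_op Num.min.
Proof.
split=> [l a b l0|]; first by rewrite minr_pMr.
by exists 1 => // a b c d; rewrite mul1r min_lipschitz.
Qed.

Lemma lattice_op_const0 : lattice_op (fun _ _ => 0).
Proof.
split=> [l a b _|]; first by rewrite mulr0.
by exists 0 => // a b c d; rewrite subrr normr0 mul0r.
Qed.

Lemma op_stable_sublattice S : S !=set0 -> op_stable S -> sublattice S.
Proof.
move=> [f0 Sf0] opS; split; first split.
- exact: (opS _ lattice_op_const0 _ _ Sf0 Sf0).
- by move=> t f g; exact: opS (lattice_op_linear t) f g.
- by move=> f g Sf Sg; split; [exact: (opS _ lattice_op_max)|exact: (opS _ lattice_op_min)].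
Qed.

Lemma HE_op_stable : op_stable (HE E).
Proof.
by move=> op [opZ _] f g fH gH l xs l0; rewrite fH// gH// opZ.
Qed.

Lemma HpE_op_stable : op_stable (HpE E p).
Proof.
move=> op lop f g /HpEP[fH [a a0 fa]] /HpEP[gH [b b0 gb]].
apply/HpEP; split; first exact: HE_op_stable.
have [K K0 opK] := lattice_op_le lop; exists (4 * K * (a + b)).
  by rewrite !mulr_ge0 ?addr_ge0.
exact: fbl_bounded_dominated fa gb _.
Qed.

Lemma HpE_closure_op_stable S : op_stable S -> op_stable (HpE_closure p S).
Proof.
move=> opS op lop f g /HpE_closureP[fH fS] /HpE_closureP[gH gS].
apply/HpE_closureP; split=> [|e e0]; first exact: HpE_op_stable.
have [_ [K K0 opK]] := lop.
pose d := e / (8 * K + 1).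
have K1 : 0 < 8 * K + 1 by lra.
have d0 : 0 < d by rewrite divr_gt0.
have [f' Sf' ff'] := fS _ d0; have [g' Sg' gg'] := gS _ d0.
exists (fun xs => op (f' xs) (g' xs)); first exact: opS.
have := fbl_bounded_dominated K0 (ltW d0) (ltW d0) ff' gg' (fun xs => opK _ _ _ _).
move=> h n xs /h/le_trans; apply; apply: ler_powR_base => //.
  by rewrite !mulr_ge0 ?addr_ge0// ltW.
have : d * (8 * K + 1) = e by rewrite divfK// gt_eqF.
lra.
Qed.

Lemma HpE_closureK S : HpE_closure p (HpE_closure p S) `<=` HpE_closure p S.
Proof.
move=> f /HpE_closureP[fH fS]; apply/HpE_closureP; split=> // e e0.
have d0 : 0 < e / 8 by rewrite divr_gt0.
have [g /HpE_closureP[_ gS] fg] := fS _ d0; have [h Sh gh] := gS _ d0.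
exists h => //.
have -> : e = 4 * 1 * (e / 8 + e / 8) by lra.
apply: fbl_bounded_dominated fg gh _ => //; rewrite ?(ltW d0)// => xs.
rewrite mul1r; have -> : f xs - h xs = f xs - g xs + (g xs - h xs) by lra.
exact: ler_normD.
Qed.

Lemma sub_HpE_closure S : S `<=` HpE E p -> S `<=` HpE_closure p S.
Proof.
move=> SH f Sf; apply/HpE_closureP; split=> [|e e0]; first exact: SH.
exists f => // n xs _; rewrite /power_sum big1 ?powR_ge0// => j _.
by rewrite subrr normr0 powR0// gt_eqF.
Qed.

(** The closure of a set of functions stable under lattice operations is a
    closed sublattice, hence contains the free Banach lattice as soon as it
    contains the evaluations. *)
Lemma FBL_sub_closure S : S `<=` HpE E p -> op_stable S ->
  range (@delta R E) `<=` S -> FBL E p `<=` HpE_closure p S.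
Proof.
move=> SH opS dS; apply: smallest_sub; last first.
  by move=> f /dS; exact: sub_HpE_closure.
split.
- by move=> f [].
- apply: op_stable_sublattice; last exact: HpE_closure_op_stable.
  by exists (delta 0); apply: sub_HpE_closure => //; apply: dS; exists 0.
- exact: HpE_closureK.
Qed.

Lemma delta_HE (x : E) : HE E (delta x).
Proof. by move=> l xs _; rewrite /delta dualZE. Qed.

Lemma delta_HpE (x : E) : HpE E p (delta x).
Proof.
apply/HpEP; split; first exact: delta_HE.
exists `|x| => // n xs xs1.
have [->|x0] := eqVneq x 0.
  rewrite /power_sum big1 ?powR_ge0// => j _.
  by rewrite /delta dual_0 normr0 powR0// gt_eqF.
have nx0 : 0 < `|x| by rewrite normr_gt0.
have -> : (fun j => delta x (xs j)) = (fun j => `|x| * xs j (`|x|^-1 *: x)).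
  by apply/funext => j; rewrite /delta dual_Z mulrA mulfV ?mul1r ?gt_eqF.
rewrite power_sum_scale normr_id ler_piMr ?powR_ge0//; apply: xs1.
by rewrite normrZ normfV normr_id mulVf// gt_eqF.
Qed.

End FreeBanachLatticeNorm.

(** * Functions that are weak-star continuous on the dual ball *)

Section IdealAndContinuity.
Context {R : realType} {E : normedModType R}.
Implicit Types (f g h : dual_space E -> R).

Lemma IE_dominated f g h : HE E h -> IE E f -> IE E g ->
  (exists K : R, forall xs, `|h xs| <= K * (`|f xs| + `|g xs|)) -> IE E h.
Proof.
move=> hH If Ig [K hK] J [[JH [J0 Jlin] Jsolid] dJ].
have Jf : J f by exact: If.
have Jg : J g by exact: Ig.
have Jabs u : J u -> J (fun xs => `|u xs|).
  move=> Ju; apply: (Jsolid _ _ _ Ju) => [l xs l0|xs]; last by rewrite normr_id.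
  by rewrite (JH _ Ju)// normrM ger0_norm.
pose s xs := 1 * `|f xs| + `|g xs|.
have Js : J s by apply: Jlin; exact: Jabs.
apply: (Jsolid _ (fun xs => K * s xs + 0) hH).
  exact: (Jlin K s _ Js J0).
by move=> xs; rewrite addr0 /s mul1r; exact: le_trans (hK xs) (ler_norm _).
Qed.

Lemma delta_IE (x : E) : IE E (delta x).
Proof. by apply: sub_gen_smallest; exists x. Qed.

(** [HpE E p] is itself an order ideal containing the evaluations. *)
Lemma IE_HpE p : 1 <= p -> IE E `<=` HpE E p.
Proof.
move=> p1; apply: smallest_sub; last by move=> _ [x _ <-]; exact: delta_HpE.
have [lin _] : sublattice (HpE E p).
  apply: op_stable_sublattice; last exact: HpE_op_stable.
  by exists (delta 0); exact: delta_HpE.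
split; [by move=> f []|exact: lin|].
move=> f g fH /(HpEP p1)[gH [c c0 gc]] fg; apply/(HpEP p1); split; first exact: fH.
exists c => // n xs xs1; apply: le_trans (gc _ _ xs1).
by apply: ler_sum => j _; exact: ler_powR_base.
Qed.

Lemma IE_op_stable : op_stable (IE E).
Proof.
move=> op lop f g If Ig; have [K K0 opK] := lattice_op_le lop.
have [fH _] := IE_HpE (lexx 1) If; have [gH _] := IE_HpE (lexx 1) Ig.
by apply: IE_dominated If Ig _; [exact: HE_op_stable|exists K].
Qed.

(** The epsilon form of weak-star continuity on the dual ball. *)
Definition wstar_continuous f : Prop :=
  forall xs : weak_star E, dual_unit_ball E xs -> forall e : R, 0 < e ->
    \forall ys \near (nbhs xs : set_system (weak_star E)),
      dual_unit_ball E ys -> `|f xs - f ys| < e.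

Lemma wstar_continuousP f :
  {within (dual_unit_ball E : set (weak_star E)),
    continuous (f : weak_star E -> R)} <-> wstar_continuous f.
Proof.
split=> [/subspace_continuousP cf xs Bxs e e0|cf].
  by have /cvgrPdist_lt/(_ _ e0) := cf xs Bxs.
apply/subspace_continuousP => xs Bxs; apply/cvgrPdist_lt => e e0.
exact: cf.
Qed.

Lemma wstar_continuous_delta (x : E) : wstar_continuous (delta x).
Proof.
move=> xs Bxs e e0.
have cx : continuous ((fun ys : dual_space E => ys x) : weak_star E -> R).
  move=> ys; apply: (@continuous_comp _ _ _ (@dual_fun R E : weak_star E -> {ptws E -> R}) (fun u => u x)).
    exact: initial_continuous.
  exact: (@proj_continuous E (fun=> R) x).
have /cvgrPdist_lt/(_ _ e0) := cx xs.
by apply: filterS => ys + _.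
Qed.

Lemma wstar_continuous_dominated f g h (K : R) : 0 <= K ->
  (forall xs ys, `|h xs - h ys| <= K * (`|f xs - f ys| + `|g xs - g ys|)) ->
  wstar_continuous f -> wstar_continuous g -> wstar_continuous h.
Proof.
move=> K0 hfg cf cg xs Bxs e e0; pose d := e / (2 * K + 1).
have K1 : 0 < 2 * K + 1 by lra.
have d0 : 0 < d by rewrite divr_gt0.
apply: filterS2 (cf _ Bxs _ d0) (cg _ Bxs _ d0) => ys fd gd Bys.
apply: le_lt_trans (hfg _ _) _.
have := fd Bys; have := gd Bys.
have : d * (2 * K + 1) = e by rewrite divfK// gt_eqF.
nra.
Qed.

Lemma IE_wstar_op_stable : op_stable (IE_wstar E).
Proof.
move=> op lop f g [If [fH /wstar_continuousP fc]] [Ig [gH /wstar_continuousP gc]].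
split; first exact: IE_op_stable.
split; first exact: HE_op_stable.
apply/wstar_continuousP; have [_ [K K0 opK]] := lop.
exact: wstar_continuous_dominated K0 (fun xs ys => opK _ _ _ _) fc gc.
Qed.

Lemma delta_IE_wstar : range (@delta R E) `<=` IE_wstar E.
Proof.
move=> _ [x _ <-]; split; first exact: delta_IE.
split; first exact: delta_HE.
by apply/wstar_continuousP; exact: wstar_continuous_delta.
Qed.

Lemma IE_wstar_HpE p : 1 <= p -> IE_wstar E `<=` HpE E p.
Proof. by move=> p1 f [/(IE_HpE p1)]. Qed.

End IdealAndContinuity.

(** * Transfer from a quotient space *)

Section Quotients.
Context {R : realType} {E : normedModType R} (W : closed_subspace E).
Notation V := (quotient_space W).
Notation pi := (quotient_map W).

Lemma quotient_map_norm_le x : `|pi x| <= `|x|.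
Proof. exact: quotient_norm_le. Qed.

Lemma quotient_lift (q : V) (r : R) : `|q| < r -> exists2 x, pi x = q & `|x| < r.
Proof.
move=> qr; apply: contrapT => h; move: qr; apply/negP; rewrite -leNgt.
apply: le_quotient_norm => x xq; rewrite leNgt; apply/negP => xr.
by apply: h; exists x.
Qed.

Lemma dual_pullback (g : dual_space V) :
  exists h : dual_space E, forall x, h x = g (pi x).
Proof.
have [M M0 gM] := dual_bounded g.
apply: (@dual_of_bounded _ _ (fun x => g (pi x)) M) => [t x y|x].
  rewrite quotient_mapD dual_D -quotient_mapZ; congr (_ + _).
  exact: dual_Z.
by apply: le_trans (gM _) _; rewrite ler_pM2l// quotient_map_norm_le.
Qed.

(** A block that annihilates the [d l], seen on [E]: its values at [x] are
    controlled by the distance from [pi x] to each [d l]. *)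
Lemma pullback_block k (d : 'I_k -> V) n : ~ finite_dimensional V ->
  exists (phi : 'I_(n * n) -> dual_space E) (y : 'I_(n * n) -> E),
    (forall j, `|y j| <= 1 /\ 1 / 16 <= phi j (y j)) /\
    forall x l, \sum_j `|phi j x| <= n%:R * `|pi x - d l| /\
      forall j, `|phi j x| <= `|pi x - d l|.
Proof.
move=> Vinf; have [f [y [fd yf fsum f1]]] := summing_block d n Vinf.
have /choice[phi phif] j := dual_pullback (f j).
have /choice[z zP] : forall j, exists z, `|z| <= 1 /\ 1 / 16 <= phi j z.
  move=> j; have [y1 fy] := yf j.
  (* A lift may be longer than [y j]; halving it costs a factor 2 in 1/8. *)
  have [|z zy z2] := @quotient_lift (y j) 2; first by lra.
  exists (2^-1 *: z); rewrite normrZ normfV [`|2|]ger0_norm//; split.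
    by rewrite ler_pdivrMl// mulr1 ltW.
  by rewrite dual_Z phif zy; lra.
exists phi, z; split=> // x l.
have phiE j : phi j x = f j (pi x - d l) by rewrite phif dual_B fd subr0.
set v := pi x - d l in phiE *.
have [v0|v0] := eqVneq v 0.
  rewrite v0 normr0 mulr0; split=> [|j]; last by rewrite phiE v0 dual_0 normr0.
  by rewrite big1// => j _; rewrite phiE v0 dual_0 normr0.
have nv0 : 0 < `|v| by rewrite normr_gt0.
have u1 : `|(`|v|^-1 *: v)| <= 1 by rewrite normrZ normfV normr_id mulVf ?gt_eqF.
have phi' j : `|phi j x| = `|v| * `|f j (`|v|^-1 *: v)|.
  by rewrite phiE dual_Z normrM normfV normr_id mulrA mulfV ?mul1r ?gt_eqF.
split=> [|j]; last by rewrite phi' ler_piMr// f1.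
under eq_bigr do rewrite phi'.
by rewrite -mulr_sumr mulrC ler_pM2r// fsum.
Qed.

Lemma dense_sequence : separable V ->
  exists d : nat -> V, forall (q : V) (e : R), 0 < e -> exists i, `|q - d i| < e.
Proof.
move=> [D /countable_injP[g ginj] Ddense].
exists (fun i => xget 0 [set v | D v /\ g v = i]) => q e e0.
have [v [qv Dv]] : ball q e `&` D !=set0.
  by apply: Ddense; [exists q; exact: ballxx|exact: ball_open].
exists (g v).
have [Dw gw] := xgetPex 0 (ex_intro (fun w => D w /\ g w = g v) v (conj Dv erefl)).
set w := xget _ _ in Dw gw *.
have -> : w = v by apply: ginj; rewrite ?inE.
by move: qv; rewrite -ball_normE.
Qed.

(** A sequence of ever larger blocks in the dual, annihilating [e], of weak
    1-summing norm at most [m + 1] and small at every fixed vector. *)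
Lemma vanishing_blocks : ~ finite_dimensional V -> separable V ->
  exists (e : E) (e' : dual_space E)
    (phi : forall m, 'I_(m.+1 * m.+1) -> dual_space E)
    (y : forall m, 'I_(m.+1 * m.+1) -> E),
    [/\ e' e = 1 /\ forall x, `|x| <= 1 -> `|e' x| <= 1,
        forall m j, phi m j e = 0,
        forall m j, `|y m j| <= 1 /\ 1 / 16 <= phi m j (y m j),
        forall m x, `|x| <= 1 ->
          \sum_j `|phi m j x| <= m.+1%:R /\ forall j, `|phi m j x| <= 1 &
        forall x (eps : R), 0 < eps -> exists M, forall m, (M <= m)%N ->
          \sum_j `|phi m j x| <= m.+1%:R * eps /\ forall j, `|phi m j x| <= eps].
Proof.
move=> Vinf /dense_sequence[d dd].
have [q q0] : exists q : V, q != 0.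
  apply: contrapT => h; apply: Vinf; exists 0%N, (fun=> 0) => v.
  exists (fun=> 0); rewrite big_ord0; apply/eqP; apply: contrapT => v0.
  by apply: h; exists v; apply/negP.
have nq0 : 0 < `|q| by rewrite normr_gt0.
have [f [lf f1 fq]] := norming_functional q.
have [|f' f'E] := dual_of_bounded (M := 1) lf; first by move=> x; rewrite mul1r.
have [e' e'E] := dual_pullback f'.
have [u uq] := quotient_map_surj q.
(* The [m]-th block annihilates [D 0, ..., D (m + 1)]; the term 0 gives the
   global bounds and the term [q] the vanishing at [e]. *)
pose D l : V := if l is l'.+1 then if l' is i.+1 then d i else q else 0.
have H m := cid (@pullback_block m.+2 (fun l => D l) m.+1 Vinf).
have H' m := cid (svalP (H m)).
pose phi m := sval (H m); pose y m := sval (H' m).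
have phiP m x l : (l < m.+2)%N ->
    \sum_j `|phi m j x| <= m.+1%:R * `|pi x - D l| /\
    forall j, `|phi m j x| <= `|pi x - D l|.
  by move=> lm; have [_ /(_ x (Ordinal lm))] := svalP (H' m).
exists (`|q|^-1 *: u), e', phi, y; split.
- split; last first.
    move=> x x1; rewrite e'E f'E; apply: le_trans (f1 _) _.
    exact: le_trans (quotient_map_norm_le _) x1.
  by rewrite dual_Z e'E f'E uq fq mulVf// gt_eqF.
- move=> m j; rewrite dual_Z; have [_ /(_ j)] := phiP m u 1%N isT.
  by rewrite uq subrr normr0 normr_le0 => /eqP->; rewrite mulr0.
- by move=> m j; have [+ _] := svalP (H' m); exact.
- move=> m x x1; have [s1 s2] := phiP m x 0%N isT.
  have px : `|pi x - D 0%N| <= 1.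
    by rewrite subr0; exact: le_trans (quotient_map_norm_le _) x1.
  split=> [|j]; last exact: le_trans (s2 j) px.
  by apply: le_trans s1 _; rewrite ler_piMr.
- move=> x eps eps0; have [i xi] := dd (pi x) _ eps0.
  exists i.+1 => m im; have [s1 s2] := phiP m x i.+2 im.
  split=> [|j]; last exact: le_trans (s2 j) (ltW xi).
  by apply: le_trans s1 _; rewrite ler_wpM2l// ltW.
Qed.

End Quotients.

(** * A function of the ideal outside the free Banach lattice *)

Section Witness.
Context {R : realType} {E : normedModType R} (p : R).
Hypothesis p1 : 1 <= p.
Context (e : E) (e' : dual_space E).
Context (phi : forall m, 'I_(m.+1 * m.+1) -> dual_space E).
Context (y : forall m, 'I_(m.+1 * m.+1) -> E).
Arguments phi : clear implicits.
Arguments y : clear implicits.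
Hypothesis e'e : e' e = 1.
Hypothesis e'1 : forall x, `|x| <= 1 -> `|e' x| <= 1.
Hypothesis phie : forall m j, phi m j e = 0.
Hypothesis phiy : forall m j, `|y m j| <= 1 /\ 1 / 16 <= phi m j (y m j).
Hypothesis phi1 : forall m x, `|x| <= 1 ->
  \sum_j `|phi m j x| <= m.+1%:R /\ forall j, `|phi m j x| <= 1.
Hypothesis phi_lim : forall x (eps : R), 0 < eps -> exists M, forall m, (M <= m)%N ->
  \sum_j `|phi m j x| <= m.+1%:R * eps /\ forall j, `|phi m j x| <= eps.

Let p0 : 0 < p. Proof. exact: lt_le_trans p1. Qed.

(** The scale of the [m]-th block: [rate m `^ p = 1 / (m + 1)]. *)
Definition rate m : R := (m.+1%:R^-1) `^ p^-1.

Let n0 m : 0 < m.+1%:R :> R. Proof. by rewrite ltr0n. Qed.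

Lemma rate_gt0 m : 0 < rate m.
Proof. by rewrite powR_gt0// invr_gt0. Qed.

Lemma rate_powR m : rate m `^ p = m.+1%:R^-1.
Proof. by rewrite /rate -powRrM mulVf ?gt_eqF// powRr1// invr_ge0 ltW. Qed.

Lemma rate_lim (eps : R) : 0 < eps -> exists M, forall m, (M <= m)%N -> rate m <= eps.
Proof.
move=> eps0; have ep0 : 0 < eps `^ p by rewrite powR_gt0.
exists (Num.trunc (eps `^ p)^-1).+1 => m Mm.
rewrite /rate powR_root_le ?invr_ge0 ?(ltW eps0)// invf_ple ?posrE//.
apply/ltW/(lt_le_trans (truncnS_gt _)).
by rewrite ler_nat ltnW.
Qed.

(** The coefficient of [e'] in the [m]-th block.  The [p]-th powers of its
    [(m + 1) ^ 2] copies add up to a constant. *)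
Definition weight m : R := rate m ^+ 2 / 4.

Lemma weight_gt0 m : 0 < weight m.
Proof. by rewrite divr_gt0// exprn_gt0// rate_gt0. Qed.

(** The [m]-th block of test functionals: a weakly bounded perturbation of
    equal multiples of [e']. *)
Definition test m j : dual_space E :=
  weight m *: e' + (rate m / 4) *: phi m j.

Arguments test : clear implicits.

Lemma testE m j x : test m j x = weight m * e' x + rate m / 4 * phi m j x.
Proof. by rewrite /test dualDE !dualZE. Qed.

Lemma power_sum_weight m (t : R) :
  power_sum p (fun _ : 'I_(m.+1 * m.+1) => weight m * t) = 4^-1 `^ p * `|t| `^ p.
Proof.
rewrite /power_sum sumr_const card_ord -[LHS]mulr_natr natrM normrM powRM//.
rewrite gtr0_norm ?weight_gt0// /weight powRM ?exprn_ge0 ?ltW ?rate_gt0//.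
rewrite expr2 powRM ?ltW ?rate_gt0// rate_powR.
have := n0 m; set n := m.+1%:R => n_gt0; field.
by rewrite gt_eqF.
Qed.

Lemma power_sum_phi m x (eps : R) : eps <= 1 ->
  \sum_j `|phi m j x| <= m.+1%:R * eps -> (forall j, `|phi m j x| <= eps) ->
  power_sum p (fun j => rate m / 4 * phi m j x) <= 4^-1 `^ p * eps.
Proof.
move=> eps1 s1 s2; rewrite power_sum_scale ger0_norm; last first.
  by rewrite divr_ge0// ltW// rate_gt0.
rewrite powRM ?invr_ge0 ?(ltW (rate_gt0 m))// rate_powR mulrAC mulrC.
rewrite ler_wpM2l ?powR_ge0// ler_pdivrMl//; apply: le_trans s1.
apply: ler_sum => j _; have [->|u0] := eqVneq `|phi m j x| 0.
  by rewrite powR0// gt_eqF.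
apply: ge1r_powR => //; rewrite lt_neqAle eq_sym u0 normr_ge0/=.
exact: le_trans (s2 j) eps1.
Qed.

Lemma quarter_powR : 2 `^ p * (4^-1 `^ p + 4^-1 `^ p) <= 1 :> R.
Proof.
have -> : 4^-1 = 2^-1 * 2^-1 :> R by lra.
rewrite powRM//.
have h : 2 `^ p * 2^-1 `^ p = 1 :> R by rewrite -powRM// mulfV ?pnatr_eq0// powR1.
have : 2^-1 `^ p <= 2^-1 :> R by apply: ge1r_powR => //; apply/andP; split; lra.
move: h; set a := 2 `^ p; set b := 2^-1 `^ p => h hb.
have -> : a * (b * b + b * b) = 2 * (a * b * b) by ring.
by rewrite h mul1r; lra.
Qed.

Lemma test_weakly_bounded m : weakly_bounded p (test m).
Proof.
move=> x x1; have [s1 s2] := phi1 m x1.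
have := @power_sum_dominated R p p1 _ (fun j => weight m * e' x)
  (fun j => rate m / 4 * phi m j x) (fun j => test m j x) 1 ler01.
move=> /(_ _)/le_trans-> //.
  by move=> j; rewrite testE mul1r ler_normD.
apply: le_trans quarter_powR; rewrite mulr1 ler_wpM2l ?powR_ge0//.
apply: lerD; last first.
  by have := @power_sum_phi m x 1 (lexx _); rewrite !mulr1; apply.
rewrite power_sum_weight ler_piMr ?powR_ge0//.
by apply: powR_base_le1 => //; exact: e'1.
Qed.

Lemma weight_weakly_bounded m :
  weakly_bounded p (fun _ : 'I_(m.+1 * m.+1) => weight m *: e').
Proof.
move=> x x1.
have -> : (fun _ : 'I_(m.+1 * m.+1) => (weight m *: e' : dual_space E) x) =
          (fun=> weight m * e' x) by apply/funext => j; rewrite dualZE.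
rewrite power_sum_weight; apply: le_trans quarter_powR.
have h : 1 <= 2 `^ p :> R by apply: le_trans (le1r_powR _ p1); rewrite ler1n.
have q0 : 0 <= 4^-1 `^ p :> R by exact: powR_ge0.
have : `|e' x| `^ p <= 1.
  by apply: powR_base_le1 => //; exact: e'1.
nra.
Qed.

(** The functions whose values on the test blocks are asymptotically those at
    [e']. *)
Definition asymptotically_constant : set (dual_space E -> R) :=
  [set g | HpE E p g /\ forall eps : R, 0 < eps -> exists M, forall m, (M <= m)%N ->
    power_sum p (fun j => g (test m j) - weight m * g e') <= eps].

Lemma delta_asymptotically_constant :
  range (@delta R E) `<=` asymptotically_constant.
Proof.
move=> _ [x _ <-]; split; first exact: delta_HpE.
move=> eps eps0; pose d := Num.min eps 1.
have d0 : 0 < d by rewrite lt_min eps0 ltr01.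
have d1 : d <= 1 by rewrite ge_min lexx orbT.
have [M HM] := phi_lim x d0; exists M => m /HM[s1 s2].
have -> : (fun j => delta x (test m j) - weight m * delta x e') =
          (fun j => rate m / 4 * phi m j x).
  by apply/funext => j; rewrite /delta testE addrC addKr.
apply: le_trans (power_sum_phi d1 s1 s2) _.
apply: (@le_trans _ _ d); last by rewrite ge_min lexx.
have h : 4^-1 `^ p <= 1 :> R.
  by apply: powR_base_le1 => //; lra.
by rewrite ler_piMl// ltW.
Qed.

Lemma asymptotically_constant_op_stable : op_stable asymptotically_constant.
Proof.
move=> op lop f g [fH f0] [gH g0].
split=> [|eps eps0]; first exact: HpE_op_stable.
have [opZ [K K0 opK]] := lop.
pose d := eps / (2 * ((2 * K) `^ p + 1)).
have K1 : 0 < 2 * ((2 * K) `^ p + 1).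
  by rewrite mulr_gt0// ltr_wpDl// powR_ge0.
have d0 : 0 < d by rewrite divr_gt0.
have [M1 HM1] := f0 _ d0; have [M2 HM2] := g0 _ d0.
exists (maxn M1 M2) => m; rewrite geq_max => /andP[/HM1 fm /HM2 gm].
have := @power_sum_dominated R p p1 _
  (fun j => f (test m j) - weight m * f e')
  (fun j => g (test m j) - weight m * g e')
  (fun j => op (f (test m j)) (g (test m j)) - weight m * op (f e') (g e')) K K0.
move=> /(_ _)/le_trans-> //.
  by move=> j; rewrite -opZ ?(ltW (weight_gt0 _)).
have : d * (2 * ((2 * K) `^ p + 1)) = eps by rewrite divfK// gt_eqF.
have : 0 <= (2 * K) `^ p by exact: powR_ge0.
nra.
Qed.

Lemma asymptotically_constant_closed :
  HpE_closure p asymptotically_constant `<=` asymptotically_constant.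
Proof.
move=> g /(HpE_closureP p1)[gH gA]; split=> // eps eps0.
pose C : R := 2 `^ p.
have C1 : 1 <= C by apply: le_trans (le1r_powR _ p1); rewrite ler1n.
have C0 : 0 < C by exact: lt_le_trans C1.
pose d := (eps / (4 * (C * C))) `^ p^-1.
have q0 : 0 < eps / (4 * (C * C)) by rewrite divr_gt0// mulr_gt0// mulr_gt0.
have d0 : 0 < d by rewrite powR_gt0.
have dp : d `^ p = eps / (4 * (C * C)).
  by rewrite /d -powRrM mulVf ?gt_eqF// powRr1// ltW.
have [h [hH h0] gh] := gA _ d0.
have [|M HM] := h0 (eps / (2 * C)); first by rewrite divr_gt0// mulr_gt0.
exists M => m /HM hm.
pose r xs := g xs - h xs.
have r1 := gh _ _ (test_weakly_bounded m).
have r2 := gh _ _ (weight_weakly_bounded m).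
have rZ : r (weight m *: e') = weight m * r e'.
  have [gZ _] := gH; have [hZ _] := hH.
  by rewrite /r gZ ?(ltW (weight_gt0 _))// hZ ?(ltW (weight_gt0 _))// mulrBr.
have r12 : power_sum p (fun j => r (test m j) - weight m * r e') <=
    C * (d `^ p + d `^ p).
  have := @power_sum_dominated R p p1 _ (fun j => r (test m j))
    (fun=> r (weight m *: e'))
    (fun j => r (test m j) - weight m * r e') 1 ler01.
  move=> /(_ _)/le_trans-> //.
    by move=> j; rewrite -rZ mul1r ler_normB.
  by rewrite mulr1 ler_wpM2l ?powR_ge0// lerD.
have := @power_sum_dominated R p p1 _ (fun j => h (test m j) - weight m * h e')
    (fun j => r (test m j) - weight m * r e')
    (fun j => g (test m j) - weight m * g e') 1 ler01.
move=> /(_ _)/le_trans-> //.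
  move=> j; rewrite mul1r; apply: le_trans (ler_normD _ _).
  by rewrite le_eqVlt; apply/orP; left; apply/eqP; congr `| _ |; rewrite /r; lra.
rewrite mulr1 -/C.
have h1 : eps / (2 * C) * C = eps / 2 by field; rewrite gt_eqF.
have h2 : C * (C * (d `^ p + d `^ p)) = eps / 2 by rewrite dp; field; rewrite gt_eqF.
apply: (@le_trans _ _ (C * (eps / (2 * C)) + C * (C * (d `^ p + d `^ p)))).
  by rewrite -mulrDr ler_pM2l// lerD.
by rewrite h2 mulrC h1; lra.
Qed.

Lemma FBL_asymptotically_constant : FBL E p `<=` asymptotically_constant.
Proof.
apply: smallest_sub; last exact: delta_asymptotically_constant.
split; last exact: asymptotically_constant_closed.
- by move=> f [].
- apply: op_stable_sublattice; last exact: asymptotically_constant_op_stable.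
  by exists (delta 0); apply: delta_asymptotically_constant; exists 0.
Qed.

(** The slope of the [m]-th bumps.  It tends to [0], which gives weak-star
    continuity; being at most [1] it makes the bumps vanish at [e']; the
    constant 64 makes the bumps full on the test functionals. *)
Definition slope m : R := (1 + (64 * rate m)^-1)^-1.

(** Truncation between 0 and [|a|] of the excess of [c * b] over [|a|]. *)
Definition bump_op (c a b : R) : R := Num.min `|a| (Num.max 0 (c * b - `|a|)).

Lemma lattice_op_bump c : 0 <= c -> lattice_op (bump_op c).
Proof.
move=> c0; split=> [l a b l0|].
  rewrite /bump_op normrM ger0_norm// minr_pMr// maxr_pMr// mulr0.
  by rewrite mulrBr mulrCA.
exists (2 + c); first by rewrite addr_ge0.
move=> a b a' b'; apply: le_trans (min_lipschitz _ _ _ _) _.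
have := max_lipschitz 0 (c * b - `|a|) 0 (c * b' - `|a'|).
rewrite subrr normr0 add0r.
have -> : c * b - `|a| - (c * b' - `|a'|) = c * (b - b') - (`|a| - `|a'|) by lra.
have := ler_normB (c * (b - b')) (`|a| - `|a'|).
rewrite normrM (ger0_norm c0).
have := ler_dist_dist a a'.
have := mulr_ge0 c0 (normr_ge0 (a - a')).
have := normr_ge0 (b - b'); have := normr_ge0 (a - a').
lra.
Qed.

Lemma slope_gt0 m : 0 < slope m.
Proof. by rewrite invr_gt0 addr_gt0// invr_gt0 mulr_gt0// rate_gt0. Qed.

Lemma slope_le1 m : slope m <= 1.
Proof.
by rewrite invf_le1 ?addr_gt0 ?invr_gt0 ?mulr_gt0 ?rate_gt0// lerDl invr_ge0 mulr_ge0// ltW// rate_gt0.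
Qed.

Lemma slope_le_rate m : slope m <= 64 * rate m.
Proof.
have r0 := rate_gt0 m; rewrite -[leRHS]invrK /slope lef_pV2 ?posrE ?addr_gt0 ?invr_gt0 ?mulr_gt0//.
by rewrite lerDr.
Qed.

Definition bump m j : dual_space E -> R :=
  fun xs => bump_op (slope m) (xs e) (xs (y m j)).

Arguments bump : clear implicits.

(** Dominated by the absolute value of the evaluation at [e], equal to it on the
    test blocks of large index, and zero at [e']. *)
Definition witness : dual_space E -> R :=
  fun xs => sup [set r | exists m j, r = bump m j xs].

Lemma bump_ge0 m j xs : 0 <= bump m j xs.
Proof. by rewrite /bump /bump_op le_min normr_ge0 le_max lexx. Qed.

Lemma bump_le_e m j xs : bump m j xs <= `|xs e|.
Proof. by rewrite /bump /bump_op ge_min lexx. Qed.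

Lemma bump_le_slope m j xs : bump m j xs <= slope m * `|xs (y m j)|.
Proof.
rewrite /bump /bump_op ge_min; apply/orP; right; rewrite ge_max.
rewrite mulr_ge0 ?(ltW (slope_gt0 _))//=.
apply: (@le_trans _ _ (slope m * xs (y m j))); first by rewrite gerBl.
by rewrite ler_pM2l ?slope_gt0// ler_norm.
Qed.

Lemma le_witness m j xs : bump m j xs <= witness xs.
Proof.
apply: ub_le_sup; last by exists m, j.
by exists `|xs e| => _ [m' [j' ->]]; exact: bump_le_e.
Qed.

Lemma witness_le xs c : (forall m j, bump m j xs <= c) -> witness xs <= c.
Proof.
move=> h; apply: ge_sup => [|_ [m [j ->]] //].
by exists (bump 0%N ord0 xs), 0%N, ord0.
Qed.

Lemma witness_ge0 xs : 0 <= witness xs.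
Proof. by apply: le_trans (@le_witness 0%N ord0 xs); exact: bump_ge0. Qed.

Lemma bump_HE m j : HE E (bump m j).
Proof.
apply: (HE_op_stable (lattice_op_bump (ltW (slope_gt0 m)))); exact: delta_HE.
Qed.

(** Homogeneity: the inequality for all nonnegative scalars gives the equality,
    applied to the inverse scalar. *)
Lemma witness_HE : HE E witness.
Proof.
have leZ (l : R) xs : 0 <= l -> witness (l *: xs) <= l * witness xs.
  move=> l0; apply: witness_le => m j; rewrite bump_HE// ler_wpM2l//.
  exact: le_witness.
move=> l xs; rewrite le_eqVlt => /predU1P[<-|l0].
  by apply/eqP; rewrite eq_le leZ//= mul0r witness_ge0.
apply/eqP; rewrite eq_le (leZ l xs (ltW l0))/= -ler_pdivlMl//.
by have := leZ l^-1 (l *: xs); rewrite scalerK ?gt_eqF// invr_ge0 (ltW l0); apply.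
Qed.

Lemma witness_IE : IE E witness.
Proof.
apply: (IE_dominated witness_HE (delta_IE e) (delta_IE e)); exists 1 => xs.
rewrite mul1r ger0_norm ?witness_ge0//; apply: witness_le => m j.
by apply: le_trans (bump_le_e _ _) _; rewrite lerDl.
Qed.

Lemma dual_unit_ball_le1 (xs : dual_space E) x :
  dual_unit_ball E xs -> `|x| <= 1 -> `|xs x| <= 1.
Proof.
move=> Bxs x1; rewrite -lee_fin; apply: le_trans Bxs; apply: ereal_sup_ubound.
by exists x.
Qed.

(** On the dual ball the [m]-th bumps are at most [slope m], so the witness is
    a uniform limit of finite suprema of weak-star continuous functions. *)
Lemma witness_wstar_continuous : wstar_continuous witness.
Proof.
move=> xs Bxs eps eps0.
have eps2 : 0 < eps / 2 by rewrite divr_gt0.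
(* Only the bumps with [m < M], finitely many, need the continuity. *)
have [M HM] : exists M, forall m, (M <= m)%N -> slope m <= eps / 2.
  have [|M HM] := @rate_lim (eps / 128); first by rewrite divr_gt0.
  exists M => m /HM h; apply: le_trans (slope_le_rate m) _; lra.
have cb m j : wstar_continuous (bump m j).
  have [_ [K K0 opK]] := lattice_op_bump (ltW (slope_gt0 m)).
  exact: wstar_continuous_dominated K0 (fun xs ys => opK _ _ _ _)
    (wstar_continuous_delta e) (wstar_continuous_delta (y m j)).
have : \forall ys \near (nbhs xs : set_system (weak_star E)),
    forall m : 'I_M, forall j,
      dual_unit_ball E ys -> `|bump m j xs - bump m j ys| < eps / 2.
  by apply: filter_forall => m; apply: filter_forall => j; exact: cb.
apply: filterS => ys near_ys Bys.
have half u v : dual_unit_ball E u ->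
    (forall (m : 'I_M) j, bump m j u <= bump m j v + eps / 2) ->
    witness u <= witness v + eps / 2.
  move=> Bu uv; apply: witness_le => m j; have [mM|Mm] := ltnP m M.
    apply: le_trans (uv (Ordinal mM) j) _.
    by rewrite lerD2r le_witness.
  apply: le_trans (bump_le_slope _ _) _.
  apply: (@le_trans _ _ (slope m)).
    rewrite ler_piMr ?(ltW (slope_gt0 _))//.
    by apply: dual_unit_ball_le1 => //; have [] := phiy j.
  by apply: le_trans (HM _ Mm) _; rewrite lerDr witness_ge0.
have h1 : witness xs <= witness ys + eps / 2.
  apply: half => // m j; have := near_ys m j Bys.
  by rewrite ltr_distlC => /andP[]; lra.
have h2 : witness ys <= witness xs + eps / 2.
  apply: half => // m j; have := near_ys m j Bys.
  by rewrite ltr_distlC => /andP[]; lra.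
by rewrite ltr_distlC; apply/andP; split; lra.
Qed.

Lemma witness_IE_wstar : IE_wstar E witness.
Proof.
split; first exact: witness_IE.
split; first exact: witness_HE.
by apply/wstar_continuousP; exact: witness_wstar_continuous.
Qed.

Lemma witness_e' : witness e' = 0.
Proof.
apply/eqP; rewrite eq_le witness_ge0 andbT; apply: witness_le => m j.
rewrite /bump /bump_op e'e normr1 ge_min; apply/orP; right.
rewrite ge_max lexx/= subr_le0.
have [y1 _] := phiy j; have := e'1 y1; rewrite ler_norml => /andP[_ ey].
apply: (@le_trans _ _ (slope m * 1)); first by rewrite ler_pM2l ?slope_gt0.
by rewrite mulr1 slope_le1.
Qed.

Lemma witness_test m j : rate m <= 1 / 96 -> weight m <= witness (test m j).
Proof.
move=> rm; apply: le_trans (le_witness j _).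
have w0 := weight_gt0 m; have r0 := rate_gt0 m; have [y1 py] := phiy j.
have := e'1 y1; rewrite ler_norml => /andP[ey _].
rewrite /bump /bump_op (testE j e) e'e phie mulr0 addr0 mulr1 gtr0_norm//.
rewrite le_min lexx/= le_max; apply/orP; right; rewrite lerBrDr.
rewrite /slope ler_pdivlMl ?addr_gt0 ?invr_gt0 ?mulr_gt0// testE.
have h : (64 * rate m)^-1 * weight m = rate m / 256.
  by rewrite /weight; field; rewrite gt_eqF.
have h2 : weight m <= rate m / 384.
  have : rate m * rate m <= rate m * (1 / 96) by rewrite ler_pM2l.
  rewrite /weight expr2; lra.
have h3 : rate m * (1 / 16) <= rate m * phi m j (y m j) by rewrite ler_pM2l.
have h4 : weight m * -1 <= weight m * e' (y m j) by rewrite ler_pM2l.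
rewrite mulrDl !mulrDr h; lra.
Qed.

Lemma witness_notin_FBL : ~ FBL E p witness.
Proof.
move=> /FBL_asymptotically_constant[_ wA].
have q0 : 0 < 4^-1 `^ p / 2 :> R by rewrite divr_gt0// powR_gt0.
have [M1 HM1] := wA _ q0.
have [|M2 HM2] := @rate_lim (1 / 96); first by lra.
have := HM1 _ (leq_maxl M1 M2); apply/negP; rewrite -ltNge.
apply: (@lt_le_trans _ _ (4^-1 `^ p)).
  by rewrite ltr_pdivrMr// ltr_pMr ?powR_gt0// ltr1n.
set m := maxn M1 M2.
have := power_sum_weight m 1; rewrite normr1 powR1 !mulr1 => <-.
apply: ler_sum => j _; rewrite witness_e' mulr0 subr0.
rewrite ger0_norm ?(ltW (weight_gt0 _))// ger0_norm ?witness_ge0//.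
apply: ler_powR_base => //; first exact/ltW/weight_gt0.
by apply: witness_test; apply: HM2; exact: leq_maxr.
Qed.

End Witness.

Theorem theorem4p3 (R : realType) (E : completeNormedModType R)
  (hE : exists W : closed_subspace E,
    ~ finite_dimensional (quotient_space W) /\ separable (quotient_space W))
  (p : R) (hp : 1 <= p) :
  ~ (IE_wstar E `<=` FBL E p) /\ FBL E p `<` HpE_closure p (IE_wstar E).
Proof.
have [W [Winf Wsep]] := hE.
have [e [e' [phi [y [[e'e e'1] phie phiy phi1 phi_lim]]]]] := vanishing_blocks Winf Wsep.
have wI := witness_IE_wstar hp e phiy.
have wF := witness_notin_FBL hp e'e e'1 phie phiy phi1 phi_lim.
split; first by move/(_ _ wI).
split.
  apply: FBL_sub_closure => //; first exact: IE_wstar_HpE.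
    exact: IE_wstar_op_stable.
  exact: delta_IE_wstar.
move=> /(_ _ (sub_HpE_closure hp (IE_wstar_HpE hp) wI)); exact: wF.
Qed.
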